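(* For all $1\le p<q\le\infty$ and $K>1$, the problem of computing the expected value $\mathbb E Y$ is solvable on the class $\mathcal Y_{p,q,K}$. In detail, for any $\varepsilon,\delta>0$, the algorithm $A_{k,1,m}^{k',s,\eta}$ with odd natural numbers $k,k'\ge 2\frac{\log\delta^{-1}}{\log(4/3)}$ and - for $1\le p<q\le2$: $m:=\lceil3\cdot48^{1/(q-1)}K^{pq/(q-p)}\rceil$, $s:=1+\frac1{q-1}$, $\eta:=16^{1/(q-1)}K^{pq/(q-p)}\varepsilon^{-(1+1/(q-1))}$; - for $1\le p<q$ and $2\le q$: $m:=\lceil144\,K^{pq/(q-p)}\rceil$, $s:=2$, $\eta:=16\,K^{pq/(q-p)}\varepsilon^{-2}$; is $(\varepsilon,\delta)$-approximating on $\mathcal Y_{p,q,K}$, i.e. $\mathbb P\{|A_{k,1,m}^{k',s,\eta}(Y)-\mathbb E Y|\le\varepsilon\}\ge1-\delta$ for all $Y\in\mathcal Y_{p,q,K}$.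
   Context: Random variables are real-valued on a probability space $(\Omega,\Sigma,\mathbb P)$; $\|X\|_q=(\mathbb E|X|^q)^{1/q}$ for $q<\infty$ and $\|X\|_\infty$ is the essential supremum of $|X|$. For $1\le p<q\le\infty$ and $K>1$, $$\mathcal Y_{p,q,K}:=\{Y\in L_q\mid \|Y-\mathbb E Y\|_q\le K\|Y-\mathbb E Y\|_p\}.$$ For $q=\infty$, $pq/(q-p)$ is read as $p$. An i.i.d.-based algorithm on a class $\mathcal Y$ of random variables consists of: an auxiliary random variable $U$ with values in a measurable space $(\mathbb U,\Sigma_U)$; a measurable $\phi:\mathbb U\times\mathbb R^{\mathbb N}\to\mathbb R$; and a measurable stopping rule $n:\mathbb U\times\mathbb R^{\mathbb N}\to\mathbb N_0\cup\{\infty\}$ such that whether $n(u,(y_j)_j)\ge i$ depends only on $(u,y_1,\dots,y_{i-1})$. For $Y\in\mathcal Y$ with i.i.d. copies $(Y_i)_{i\in\mathbb N}$, independent of $U$, put $n(\omega,Y):=n(U(\omega),(Y_i(\omega))_i)$, assumed almost surely finite for each $Y\in\mathcal Y$, and $A(\omega,Y):=\phi(U(\omega),Y_1(\omega),\dots,Y_{n(\omega,Y)}(\omega),0,0,\dots)$; $A(Y):=A(\cdot,Y)$. The problem is solvable on $\mathcal Y$ if for all $\varepsilon>0$, $\delta\in(0,1)$ there is an i.i.d.-based algorithm $A$ that is $(\varepsilon,\delta)$-approximating on $\mathcal Y$: $\mathbb P\{|A(Y)-\mathbb E Y|\le\varepsilon\}\ge1-\delta$ for all $Y\in\mathcal Y$.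 Algorithm $A_{k,p,m}^{k',s,\eta}$ (parameters: odd natural numbers $k,k'$; integer $m\ge2$; reals $p,s\ge1$, $\eta$ positive). Input: i.i.d. copies $Y_1,Y_2,\dots$ of $Y$. Stage 1: put $n_1:=km$ and for $\ell=1,\dots,k$ $$\widehat M_m^{(\ell)}:=\frac1m\sum_{i=(\ell-1)m+1}^{\ell m}Y_i,\qquad \widehat R_m^{(\ell)}:=\frac1m\sum_{i=(\ell-1)m+1}^{\ell m}|Y_i-\widehat M_m^{(\ell)}|^p,$$ and let $\widehat R_{k,m}$ be the median of $\widehat R_m^{(1)},\dots,\widehat R_m^{(k)}$. Stage 2: put $m':=\max\{\lceil\eta(\widehat R_{k,m})^s\rceil,1\}$ and for $\ell=1,\dots,k'$ $$\widetilde M_{m'}^{(\ell)}:=\frac1{m'}\sum_{i=n_1+(\ell-1)m'+1}^{n_1+\ell m'}Y_i.$$ The output $A_{k,p,m}^{k',s,\eta}(Y)$ is the median of $\widetilde M_{m'}^{(1)},\dots,\widetilde M_{m'}^{(k')}$. In the claim the exponent used in stage 1 is $1$. *)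

(* Defs.v *)
From HB Require Import structures.
From mathcomp Require Import all_boot all_order all_algebra.
From mathcomp Require Import all_classical all_reals all_analysis.

Set Implicit Arguments.
Unset Strict Implicit.
Unset Printing Implicit Defensive.

Import Order.TTheory GRing.Theory Num.Theory.
Import numFieldNormedType.Exports.

Local Open Scope classical_set_scope.
Local Open Scope ring_scope.

(* Sequences are indexed from 0: the paper's y_j, j >= 1, is [y j.-1] here.
   R^N carries the product sigma-algebra, generated by the coordinate maps. *)
Definition coordinate_sets (R : realType) : set (set (nat -> R)) :=
  \bigcup_i preimage_set_system setT (fun y : nat -> R => y i) measurable.

Arguments coordinate_sets : clear implicits.

Definition realseq (R : realType) := g_sigma_algebraType (coordinate_sets R).

(* A class of random variables; its members may live on any probability
   space. *)
Definition rv_class (R : realType) :=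
  forall (d : measure_display) (T : measurableType d) (P : probability T R),
    {RV P >-> R} -> Prop.

Definition mean (R : realType) (d : measure_display) (T : measurableType d)
    (P : probability T R) (Y : {RV P >-> R}) : R := fine 'E_P[Y].

(* [EFin \o f] is the embedding of f into the extended reals, on which the
   library's L^q norm is defined; [q] may be +oo. *)
Definition central_norm (R : realType) (d : measure_display)
    (T : measurableType d) (P : probability T R) (q : \bar R)
    (Y : {RV P >-> R}) : \bar R :=
  Lnorm P q (EFin \o (fun w => Y w - mean Y)).

Definition classY (R : realType) (p : R) (q : \bar R) (K : R) : rv_class R :=
  fun d T P Y =>
    (Y : T -> R) \in Lfun P q /\
    (central_norm q Y <= K%:E * central_norm p%:E Y)%E.

(* pq/(q-p), read as p for q = +oo. *)
Definition pq_exponent (R : realType) (p : R) (q : \bar R) : R :=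
  if q is r%:E then p * r / (r - p) else p.

(* The auxiliary variable U enters only through its value space and its law.
   The value [None] of [stop] stands for infinity. *)
Record procedure (R : realType) := Procedure {
  aux_disp : measure_display;
  aux_space : measurableType aux_disp;
  aux_law : probability aux_space R;
  phi : aux_space * realseq R -> R;
  stop : aux_space * realseq R -> option nat
}.

Definition stop_ge (i : nat) (n : option nat) : bool :=
  if n is Some N then (i <= N)%N else true.

Definition nonanticipating (R : realType) (A : procedure R) :=
  forall (i : nat) (u : aux_space A) (y y' : realseq R),
    (forall j : nat, (j.+1 < i)%N -> y j = y' j) ->
    stop_ge i (stop (u, y)) = stop_ge i (stop (u, y')).

Definition truncate (R : realType) (n : option nat) (y : realseq R)
    : realseq R :=
  if n is Some N then (fun j : nat => if (j < N)%N then y j else 0) else y.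

Definition run (R : realType) (A : procedure R) (u : aux_space A)
    (y : realseq R) : R :=
  phi (u, truncate (stop (u, y)) y).

(* Joint independence of the countable family U, X 0, X 1, ...; subfamilies
   not containing U are covered by taking B = setT. *)
Definition jointly_independent (R : realType) (d d' : measure_display)
    (T : measurableType d) (S : measurableType d') (P : probability T R)
    (U : {RV P >-> S}) (X : nat -> {RV P >-> R}) :=
  forall (J : seq nat) (B : set S) (C : nat -> set R),
    uniq J -> measurable B -> (forall i, measurable (C i)) ->
    (P (U @^-1` B `&` [set w | forall i, i \in J -> C i (X i w)]) =
     P (U @^-1` B) * \prod_(i <- J) P (X i @^-1` C i))%E.

(* On (T', P'): U has the law prescribed by A, and the X i are i.i.d. copies
   of Y independent of U. The space (T, P) of Y itself need not be rich enough
   to carry such a sequence, hence the second space. *)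
Definition iid_input (R : realType) (A : procedure R)
    (d : measure_display) (T : measurableType d) (P : probability T R)
    (Y : {RV P >-> R})
    (d' : measure_display) (T' : measurableType d') (P' : probability T' R)
    (U : {RV P' >-> aux_space A}) (X : nat -> {RV P' >-> R}) :=
  [/\ forall B, measurable B -> distribution P' U B = aux_law A B,
      forall i B, measurable B -> distribution P' (X i) B = distribution P Y B
    & jointly_independent U X].

Definition as_finite (R : realType) (A : procedure R) (Y_ : rv_class R) :=
  forall (d : measure_display) (T : measurableType d) (P : probability T R)
    (Y : {RV P >-> R}), Y_ d T P Y ->
  forall (d' : measure_display) (T' : measurableType d')
    (P' : probability T' R) (U : {RV P' >-> aux_space A})
    (X : nat -> {RV P' >-> R}), iid_input Y U X ->
  {ae P', forall w, stop (U w, (fun i => X i w) : realseq R) <> None}.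

Definition iid_based (R : realType) (A : procedure R) (Y_ : rv_class R) :=
  [/\ measurable_fun setT (@phi R A),
      forall n : option nat,
        measurable [set x : aux_space A * realseq R | stop x = n],
      nonanticipating A
    & as_finite A Y_].

Definition approximating (R : realType) (A : procedure R) (eps delta : R)
    (Y_ : rv_class R) :=
  forall (d : measure_display) (T : measurableType d) (P : probability T R)
    (Y : {RV P >-> R}), Y_ d T P Y ->
  forall (d' : measure_display) (T' : measurableType d')
    (P' : probability T' R) (U : {RV P' >-> aux_space A})
    (X : nat -> {RV P' >-> R}), iid_input Y U X ->
  ((1 - delta)%:E <=
    P' [set w | (`|run (U w) (fun i => X i w) - mean Y| <= eps)%R])%E.

Definition solvable (R : realType) (Y_ : rv_class R) :=
  forall eps delta : R, 0 < eps -> 0 < delta -> delta < 1 ->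
  exists A : procedure R, iid_based A Y_ /\ approximating A eps delta Y_.

(* The middle order statistic; the median for sequences of odd length, the
   only ones it is used for. *)
Definition median (R : realType) (s : seq R) : R :=
  nth 0 (sort <=%R s) (size s)./2.

(* The sample y_(a+1), ..., y_(a+m) in the paper's indexing. *)
Definition block_mean (R : realType) (y : nat -> R) (a m : nat) : R :=
  (\sum_(a <= i < a + m) y i) / m%:R.

Definition block_dev (R : realType) (p : R) (y : nat -> R) (a m : nat) : R :=
  (\sum_(a <= i < a + m) `|y i - block_mean y a m| `^ p) / m%:R.

Definition ceiln (R : realType) (x : R) : nat := `|Num.max (Num.ceil x) 0|%N.

Section two_stage.
Context {R : realType} (k k' m : nat) (p s eta : R).
Implicit Types y : nat -> R.

Definition stage1 y : R :=
  median (mkseq (fun l => block_dev p y (l * m) m) k).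

Definition stage2_size y : nat := maxn (ceiln (eta * stage1 y `^ s)) 1.

Definition stage2 y : R :=
  let m' := stage2_size y in
  median (mkseq (fun l => block_mean y (k * m + l * m') m') k').

Definition two_stage : procedure R :=
  @Procedure R _ unit (dirac tt)
    (fun x => stage2 x.2)
    (fun x => Some (k * m + k' * stage2_size x.2)%N).

End two_stage.

Arguments two_stage {R} k k' m p s eta.

(* Main.v *)
(* Put Z = Y - E Y.  Lyapunov's inequality turns membership in the class into
   E|Z|^r <= kappa^(r-1) (E|Z|)^r with kappa = K^(pq/(q-p)), for every real
   r in [1, q]; it is used with r = min(q, 2).
   Stage 1: on one block the empirical absolute deviation is at least the mean
   of the |Y_i - E Y| minus the error of the empirical mean.  The first falls
   below (3/4) E|Z| with probability at most 1/12, by a Laplace transform bound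
   (lower tails of nonnegative variables need only an r-th moment), the second
   exceeds E|Z|/4 with probability at most 1/6, by the von Bahr-Esseen
   inequality with constant 2^(2-r).  So one block undershoots E|Z|/2 with
   probability at most 1/4.
   Stage 2: once the stage 1 median is at least E|Z|/2, the block length m' is
   such that the von Bahr-Esseen inequality bounds the probability of a bad
   block mean by 1/4; the random m' is handled by independence of the stages.
   Medians: the median of k = 2n+1 independent blocks is bad with probability
   at most P(Bin(k, 1/4) > n) <= (1/4) (3/4)^n <= delta/2. *)
From HB Require Import structures.
Require Import Defs.
From mathcomp Require Import all_boot all_order all_algebra.
From mathcomp Require Import all_classical all_reals all_analysis.
From mathcomp Require Import measurable_realfun ess_sup_inf ring lra zify.

Set Implicit Arguments.
Unset Strict Implicit.
Unset Printing Implicit Defensive.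

Import Order.TTheory GRing.Theory Num.Theory.
Import numFieldNormedType.Exports.

Local Open Scope classical_set_scope.
Local Open Scope ring_scope.

(** * Inequalities for powers and the exponential *)

Section powR_inequalities.
Variable R : realType.
Implicit Types a b r t u x y : R.

(** The obstacle is that E|Z|^r may be the only control available, with r close to 1 and possibly
    infinite variance, so an estimate of the scale can overshoot wildly. An overestimate of E|Z|
    only lengthens stage 2, which remains finite; accuracy depends on excluding underestimates,
    hence the one-sided analysis of stage 1. Moment bounds for the mean of n samples decay like
    n^(-(r-1)). Solving them for n produces the exponents 1/(r-1) in [m] and [eta], and r/(r-1) = 1
    + 1/(r-1) as the power of the scale. Such bounds give only polynomial confidence, so each block
    is asked for failure probability 1/4 and the medians supply the exponential decay in k and k'.
    The bound kappa^(t-1) mu^t on the t-th moment, where mu = E|Z|, is log-affine in t and equals mu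
    at t = 1. It is therefore stable under interpolation between 1 and q, and the same kappa serves
    for every r. Conditional expectations are replaced by product formulas: an independent new
    sample is integrated out while a function of the earlier ones is held fixed, and the random
    block length is treated by summing over its values. *)

Lemma powR_weighted_amgm t x y : 0 < t -> t < 1 -> 0 <= x -> 0 <= y ->
  x `^ t * y `^ (1 - t) <= t * x + (1 - t) * y.
Proof.
move=> t0 t1 x0 y0.
have := @conjugate_powR R (x `^ t) (y `^ (1 - t)) t^-1 (1 - t)^-1
  (powR_ge0 _ _) (powR_ge0 _ _).
rewrite !invr_gt0 subr_gt0 !invrK [t + _]addrC subrK => /(_ t0 t1 erefl).
rewrite -!powRrM !mulfV ?gt_eqF ?subr_gt0//.
by rewrite !powRr1// [x * _]mulrC [y * _]mulrC.
Qed.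

(** The ratio u = x/(x+y) lies in (0,1], so u <= u^b. Multiplying by (x+y)^b and adding the same
    bound for y gives the claim, since the two ratios sum to 1. *)
Lemma powR_subadditive b x y : 0 < b -> b <= 1 -> 0 <= x -> 0 <= y ->
  (x + y) `^ b <= x `^ b + y `^ b.
Proof.
move=> b0 b1; rewrite le_eqVlt => /predU1P[<- _|x0].
  by rewrite add0r lerDr powR_ge0.
rewrite le_eqVlt => /predU1P[<-|y0]; first by rewrite addr0 lerDl powR_ge0.
have s0 : 0 < x + y by rewrite addr_gt0.
have h z : 0 < z -> z <= x + y -> z / (x + y) * (x + y) `^ b <= z `^ b.
  move=> z0 zs; have {2}-> : z = z / (x + y) * (x + y).
    by rewrite divfK// gt_eqF.
  have zs0 : 0 < z / (x + y) by rewrite divr_gt0.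
  rewrite [leRHS]powRM; try exact: ltW.
  apply: ler_wpM2r; rewrite ?powR_ge0//.
  by rewrite ger1_powR// zs0/= ler_pdivrMr ?mul1r.
have hx := h x x0; have hy := h y y0.
apply: le_trans (lerD (hx _) (hy _)); rewrite ?lerDl ?lerDr; try exact: ltW.
by rewrite -mulrDl -mulrDl divff ?mul1r// gt_eqF.
Qed.

(** Convexity of t^(1/b) at the midpoint of x^b and y^b, followed by raising both sides to the power
    b. *)
Lemma powR_midpoint_concave b x y : 0 < b -> b <= 1 -> 0 <= x -> 0 <= y ->
  x `^ b + y `^ b <= 2 `^ (1 - b) * (x + y) `^ b.
Proof.
move=> b0 b1 x0 y0.
have h12 : 0 <= 2^-1 :> R by rewrite invr_ge0.
have h12' : 2^-1 <= 1 :> R by rewrite invf_le1// ler1n.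
have b1' : 1 <= b^-1 by rewrite invf_ge1.
have := @convex_powR R b^-1 b1' (Itv01 h12 h12') (x `^ b) (y `^ b).
rewrite !inE/= !in_itv/= !andbT => /(_ (powR_ge0 _ _) (powR_ge0 _ _)).
rewrite convRE [X in X `^ _ <= _]convRE/= /unstable.onem -!powRrM mulfV ?gt_eqF// !powRr1//.
rewrite (_ : 1 - 2^-1 = 2^-1 :> R); last by field.
rewrite -!mulrDr => h.
have {h} := ge0_ler_powR (ltW b0) _ _ h.
rewrite !nnegrE powR_ge0 -powRrM mulVf ?gt_eqF//.
rewrite powRr1 ?mulr_ge0 ?addr_ge0 ?powR_ge0// => /(_ erefl).
move=> /(_ isT).
rewrite powRM ?addr_ge0// -ler_pdivlMl ?invr_gt0// invrK => /le_trans; apply.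
rewrite mulrA; apply: ler_wpM2r; rewrite ?powR_ge0// powRB ?pnatr_eq0 ?implybT//.
rewrite powRr1//; apply: ler_wpM2l => //.
by rewrite -powR_inv1// -powRrM mulrC powRrM powR_inv1 ?powR_ge0.
Qed.

Lemma norm_powR_cvg0 b : 0 < b -> (`|y| `^ b) @[y --> (0 : R)] --> (0 : R).
Proof.
move=> b0; apply/cvgrPdist_lt => e e0.
have := @nbhs0_lt R R _ (powR_gt0 b^-1 e0); apply: filterS => y ye.
rewrite sub0r normrN ger0_norm ?powR_ge0//.
have -> : e = (e `^ b^-1) `^ b by rewrite -powRrM mulVf ?gt_eqF// powRr1// ltW.
by apply: gt0_ltr_powR; rewrite ?nnegrE ?powR_ge0.
Qed.

(** Away from 0 the function agrees locally with y^r or (-y)^r. At 0 the difference quotient has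
    absolute value |h|^(r-1), which tends to 0 as r > 1; since sg 0 = 0, one formula covers all
    cases. *)
Lemma is_derive_norm_powR r x : 1 < r ->
  is_derive x 1 (fun y => `|y| `^ r) (r * (Num.sg x * `|x| `^ (r - 1))).
Proof.
move=> r1; have r0 : 0 < r by rewrite (lt_trans ltr01).
have [x0|x0|->] := ltgtP x 0.
- have nE : {near x, (fun y => (- y) `^ r) =1 (fun y => `|y| `^ r)}.
    near=> y; have y0 : y < 0 by near: y; exact: lt_nbhsl.
    by rewrite ltr0_norm.
  rewrite (_ : r * _ = r * (- x) `^ (r - 1) * (- 1)); last first.
    by rewrite ltr0_sg// ltr0_norm// mulN1r mulrN mulrN1.
  apply: near_eq_is_derive nE _.
  have Nx0 : 0 < - x by rewrite oppr_gt0.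
  exact: (@is_derive1_comp R (fun y => y `^ r) -%R x _ _
    (is_derive1_powR r Nx0) (is_deriveNid x 1)).
- have nE : {near x, (fun y => y `^ r) =1 (fun y => `|y| `^ r)}.
    near=> y; have y0 : 0 < y by near: y; exact: lt_nbhsr.
    by rewrite gtr0_norm.
  apply: near_eq_is_derive nE _.
  by rewrite gtr0_sg// gtr0_norm// mul1r; exact: is_derive1_powR.
- rewrite sgr0 mul0r mulr0.
  have lim0 : h^-1 *: ((fun y : R => `|y| `^ r) (h *: (1 : R) + 0) - `|0 : R| `^ r)
      @[h --> (0 : R)^'] --> (0 : R).
    apply/(@cvgrPdist_lt R R) => e e0.
    have r10 : 0 < r - 1 by rewrite subr_gt0.
    have /cvgrPdist_lt/(_ e e0) h := norm_powR_cvg0 r10.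
    near=> y; have y0 : y != 0 by near: y; exact: nbhs_dnbhs_neq.
    rewrite sub0r normrN normr0 powR0 ?gt_eqF// subr0 addr0.
    rewrite /GRing.scale/= mulr1 normrM normfV ger0_norm ?powR_ge0//.
    rewrite -mulr_powRB1// mulKf ?normr_eq0//.
    have : `|0 - `|y| `^ (r - 1)| < e by near: y; exact: nbhs_dnbhs.
    by rewrite sub0r normrN ger0_norm ?powR_ge0.
  split; first by apply/cvg_ex; exists 0.
  exact/cvg_lim.
Unshelve. all: by end_near. Qed.

(* The right side minus the left side vanishes at y = 0; its derivative in y is
   nonnegative by subadditivity of t^(r-1) when x and x + y have the same sign,
   by its midpoint concavity otherwise. *)
Lemma norm_powR_add_le r x y : 1 < r -> r <= 2 ->
  `|x + y| `^ r <=
  `|x| `^ r + r * (Num.sg x * `|x| `^ (r - 1)) * y + 2 `^ (2 - r) * `|y| `^ r.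
Proof.
move=> r1 r2.
wlog y0 : x y / 0 <= y.
  move=> h; have [|/ltW y0] := leP 0 y; first exact: h.
  have := h (- x) (- y); rewrite -opprD !normrN sgrN oppr_ge0 => /(_ y0).
  by rewrite !mulNr !mulrN mulNr opprK.
set C := 2 `^ (2 - r).
pose g z := `|x| `^ r + r * (Num.sg x * `|x| `^ (r - 1)) * z
  + C * `|z| `^ r - `|x + z| `^ r.
suff : g 0 <= g y.
  rewrite /g addr0 normr0 powR0 ?gt_eqF ?(lt_trans ltr01)// !mulr0 !addr0 subrr.
  by rewrite subr_ge0.
have b0 : 0 < r - 1 by rewrite subr_gt0.
have b1 : r - 1 <= 1 by lra.
have dg (z : R) : is_derive z (1 : R) g (r * (Num.sg x * `|x| `^ (r - 1))
    + C * (r * (Num.sg z * `|z| `^ (r - 1)))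
    - r * (Num.sg (x + z) * `|x + z| `^ (r - 1))).
  have d1 := is_derive_norm_powR z r1.
  have d2 := is_derive_norm_powR (x + z) r1.
  have d3 : is_derive z (1 : R) (fun z : R => `|x + z| `^ r)
      (r * (Num.sg (x + z) * `|x + z| `^ (r - 1)) * 1).
    apply: (@is_derive1_comp R (fun z : R => `|z| `^ r) (+%R x)) => //.
    have := is_deriveD (is_derive_cst x z (1 : R)) (is_derive_id z (1 : R)).
    by rewrite add0r.
  rewrite mulr1 in d3.
  have d4 := is_deriveB (is_deriveD (is_deriveD (is_derive_cst (`|x| `^ r) z (1 : R))
    (is_deriveZ (r * (Num.sg x * `|x| `^ (r - 1))) (is_derive_id z (1 : R))))
    (is_deriveZ C d1)) d3.
  by apply: is_derive_eq d4 _; rewrite add0r /GRing.scale/= mulr1.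
have C1 : 1 <= C.
  by rewrite -(powRr0 2); apply: ler_powR; rewrite ?ler1n ?subr_ge0.
have key (z : R) : 0 < z -> Num.sg (x + z) * `|x + z| `^ (r - 1) <=
    Num.sg x * `|x| `^ (r - 1) + C * z `^ (r - 1).
  move=> z0.
  have hC : z `^ (r - 1) <= C * z `^ (r - 1) by rewrite ler_peMl ?powR_ge0.
  have [x0|x0|->] := ltgtP x 0.
  - rewrite (ltr0_sg x0) (ltr0_norm x0) mulN1r.
    have [xz0|xz0|xz0] := ltgtP (x + z) 0.
    + rewrite ltr0_sg// ltr0_norm// mulN1r.
      have := @powR_subadditive (r - 1) (- (x + z)) z b0 b1.
      rewrite (_ : - (x + z) + z = - x); last by ring.
      by rewrite oppr_ge0 => /(_ (ltW xz0) (ltW z0)); lra.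
    (* The sign change is what fixes the constant: z = |x| + (x + z), and midpoint concavity with
       exponent r - 1 has the factor 2^(1-(r-1)) = [C]. The other cases use [C >= 1]. *)
    + rewrite gtr0_sg// gtr0_norm// mul1r.
      have := @powR_midpoint_concave (r - 1) (- x) (x + z) b0 b1.
      rewrite (_ : - x + (x + z) = z); last by ring.
      rewrite (_ : 1 - (r - 1) = 2 - r); last by ring.
      rewrite -/C oppr_ge0 => /(_ (ltW x0) (ltW xz0)).
      by lra.
    + rewrite xz0 sgr0 mul0r.
      have : (- x) `^ (r - 1) <= z `^ (r - 1).
        by apply: ge0_ler_powR; rewrite ?nnegrE; lra.
      by lra.
  - rewrite !gtr0_sg ?addr_gt0// !gtr0_norm ?addr_gt0// !mul1r.
    have := @powR_subadditive (r - 1) x z b0 b1 (ltW x0) (ltW z0).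
    by lra.
  - by rewrite add0r sgr0 mul0r add0r gtr0_sg// gtr0_norm// mul1r.
apply: (@ger0_derive1_ndecry R g 0) => //.
- move=> z; rewrite in_itv/= andbT => z0.
  rewrite derive1E derive_val (gtr0_sg z0) (gtr0_norm z0) mul1r.
  have := ler_wpM2l (ltW (lt_trans ltr01 r1)) (key z z0).
  by lra.
- by apply: derivable_within_continuous => z _; exact: ex_derive.
Qed.

(** The bounds 1 - x + x^2/2 and 1 = 1 - x + x cross at x = 2, and 2^(1-r) x^r takes there the
    common value 2 of x^2/2 and x. Its exponent lies between 1 and 2, so it dominates x^2/2 before
    the crossing and x after it. *)
Lemma expRN_le r x : 1 <= r -> r <= 2 -> 0 <= x ->
  expR (- x) <= 1 - x + 2 `^ (1 - r) * x `^ r.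
Proof.
move=> r1 r2 x0.
have quad : expR (- x) <= 1 - x + x ^+ 2 / 2.
  pose g (z : R) := (1 - z + z ^+ 2 / 2) - expR (- z).
  suff : g 0 <= g x.
    by rewrite /g oppr0 expR0 expr0n/= mul0r !addr0 subrr subr_ge0.
  have dg (z : R) : is_derive z (1 : R) g (- 1 + z + expR (- z)).
    have d1 : is_derive z (1 : R) (fun z : R => expR (- z)) (expR (- z) * -1).
      exact: (@is_derive1_comp R expR -%R z _ _ (is_derive_expR _) (is_deriveNid z 1)).
    have d2 := is_deriveB (is_deriveD (is_deriveB (is_derive_cst (1 : R) z (1 : R))
      (is_derive_id z (1 : R)))
      (is_deriveZ (2^-1 : R) (is_deriveX 2 (is_derive_id z (1 : R))))) d1.
    rewrite (_ : g = cst 1 - id + 2^-1 *: (id ^+ 2) - (fun z => expR (- z))).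
      by apply: is_derive_eq d2 _; rewrite /GRing.scale/=; field.
    by apply/funext => w; rewrite /g !fctE /GRing.scale/= [_ / 2]mulrC.
  apply: (@ger0_derive1_ndecry R g 0) => //.
  - move=> z _.
    rewrite derive1E derive_val.
    have := expR_ge1Dx (- z); lra.
  - by apply: derivable_within_continuous => z _; exact: ex_derive.
have lin : expR (- x) <= 1 - x + x.
  by rewrite subrK -expR0 ler_expR oppr_le0.
have [x2|x2] := leP x 2.
  apply: (le_trans quad); rewrite lerD2l.
  have -> : x ^+ 2 / 2 = 2 `^ (1 - r) * x `^ r * (x / 2) `^ (2 - r).
    rewrite powRM ?invr_ge0// -(powR_inv1 (_ : 0 <= 2))// -powRrM.
    rewrite (_ : _ * _ * _ = (2 `^ (1 - r) * 2 `^ (-1 * (2 - r))) *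
      (x `^ r * x `^ (2 - r))); last by ring.
    rewrite -powRD ?pnatr_eq0 ?implybT// -powRD; last first.
      by rewrite addrC subrK pnatr_eq0.
    rewrite (_ : 1 - r + -1 * (2 - r) = -1); last by ring.
    by rewrite (_ : r + (2 - r) = 2) ?powR_mulrn 1?mulrC//; ring.
  rewrite ler_piMr ?mulr_ge0 ?powR_ge0//.
  have e1 : 1 `^ (2 - r) = 1 :> R by rewrite powR1.
  rewrite -[leRHS]e1.
  by apply: ge0_ler_powR; rewrite ?nnegrE; lra.
apply: (le_trans lin); rewrite lerD2l.
have {1}-> : x = 2 `^ (1 - r) * x `^ r * (2 / x) `^ (r - 1).
  have x0' : x != 0 by rewrite gt_eqF// (lt_trans _ x2).
  rewrite powRM ?invr_ge0// -(powR_inv1 x0) -powRrM.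
  rewrite (_ : _ * _ * _ = (2 `^ (1 - r) * 2 `^ (r - 1)) *
      (x `^ r * x `^ (-1 * (r - 1)))); last by ring.
  rewrite -!powRD ?pnatr_eq0 ?x0' ?implybT//.
  rewrite (_ : 1 - r + (r - 1) = 0); last by ring.
  by rewrite (_ : r + -1 * (r - 1) = 1) ?powRr0 ?powRr1 ?mul1r//; ring.
rewrite ler_piMr ?mulr_ge0 ?powR_ge0//.
have e1 : 1 `^ (r - 1) = 1 :> R by rewrite powR1.
rewrite -[leRHS]e1.
apply: ge0_ler_powR; rewrite ?nnegrE ?divr_ge0//; try lra.
by rewrite ler_pdivrMr; lra.
Qed.

End powR_inequalities.

(** * Binomial tails and medians *)

Section binomial_tail.
Variable R : realType.

(* P(Bin(k, 1/4) >= h) and the number of subsets of k points with at least h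
   elements. *)
Fixpoint quarter_tail (k h : nat) : R :=
  match h, k with
  | 0%N, _ => 1
  | _.+1, 0%N => 0
  | h'.+1, k'.+1 => 4^-1 * quarter_tail k' h' + 3 / 4 * quarter_tail k' h
  end.

Fixpoint subset_tail (k h : nat) : nat :=
  match h, k with
  | 0%N, _ => 2 ^ k
  | _.+1, 0%N => 0
  | h'.+1, k'.+1 => subset_tail k' h' + subset_tail k' h
  end.

Lemma quarter_tail0 k : quarter_tail k 0 = 1. Proof. by case: k. Qed.

Lemma subset_tail_eq0 k h : (k < h)%N -> subset_tail k h = 0%N.
Proof.
elim: k h => [|k IH] [|h]//=; rewrite ltnS => kh.
by rewrite !IH// ltnW.
Qed.

(** Complementation: as a + b = k + 1, a set of points has at least b elements exactly when its
    complement has fewer than a. *)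
Lemma subset_tail_sym k a b : (a + b = k.+1)%N ->
  (subset_tail k a + subset_tail k b = 2 ^ k)%N.
Proof.
elim: k a b => [|k IH] [|a] [|b]//=.
- by rewrite addSn addnS.
- by rewrite add0n => -[->]; rewrite (subset_tail_eq0 (ltnSn k))
    (subset_tail_eq0 (leqW (ltnSn k))) !addn0.
- by rewrite addn0 => -[->]; rewrite (subset_tail_eq0 (ltnSn k))
    (subset_tail_eq0 (leqW (ltnSn k))) !add0n.
rewrite addSn addnS => -[abk].
have h1 := IH a b.+1; have h2 := IH a.+1 b.
rewrite addnS abk in h1; rewrite addSn abk in h2.
by rewrite expnS; move: (2 ^ k)%N (h1 erefl) (h2 erefl) => c; lia.
Qed.

Lemma subset_tail_half n : subset_tail n.*2.+1 n.+1 = (2 ^ n.*2)%N.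
Proof.
apply/eqP; rewrite -(eqn_pmul2l (isT : 0 < 2)%N) -expnS mul2n -addnn.
by apply/eqP/subset_tail_sym; rewrite addSn addnS addnn.
Qed.

(** A set of j >= h successes has probability 3^(k-j)/4^k, hence at most 3^(k-h)/4^k. The powers are
    multiplied out to avoid truncated subtraction, and the induction follows the common Pascal-type
    recursion. *)
Lemma quarter_tail_le_subset k h :
  4 ^+ k * 3 ^+ h * quarter_tail k h <= 3 ^+ k * (subset_tail k h)%:R.
Proof.
elim: k h => [|k IH] [|h] /=.
- by rewrite !expr0 !mulr1.
- by rewrite !mulr0.
- rewrite expr0 !mulr1 natrX -exprMn; apply: lerXn2r; rewrite ?nnegrE//; lra.
have h1 := IH h; have h2 := IH h.+1.
rewrite natrD; move: h1 h2; rewrite !exprS.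
set a := 4 ^+ k; set b := 3 ^+ h; set c := 3 ^+ k => h1 h2.
rewrite (_ : 4 * a * (3 * b) * _ = 3 * (a * b * quarter_tail k h)
  + 3 * (a * (3 * b) * quarter_tail k h.+1)); last by field.
by lra.
Qed.

(** By symmetry 4^n of the subsets of 2n+1 points have at least n+1 elements, and each contributes
    at most 3^n/4^(2n+1). *)
Lemma quarter_tail_half n : quarter_tail n.*2.+1 n.+1 <= 4^-1 * (3 / 4) ^+ n.
Proof.
have := quarter_tail_le_subset n.*2.+1 n.+1.
rewrite subset_tail_half natrX -muln2 !exprS !exprM.
set q := quarter_tail _ _.
rewrite [(3 ^+ n) ^+ 2]expr2 [(4 ^+ n) ^+ 2]expr2 expr_div_n.
rewrite -[(2 ^+ n) ^+ 2]exprM mulnC exprM (_ : 2 ^+ 2 = 4 :> R); last by ring.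
have a0 : 0 < 3 ^+ n :> R by rewrite exprn_gt0.
have b0 : 0 < 4 ^+ n :> R by rewrite exprn_gt0.
set a := 3 ^+ n in a0 *; set b := 4 ^+ n in b0 * => h.
rewrite mulrA ler_pdivlMr// -(@ler_pM2l _ (12 * a * b)); last first.
  by rewrite !mulr_gt0.
rewrite (_ : 12 * a * b * (q * b) = 4 * (b * b) * (3 * a) * q); last by ring.
by apply: (le_trans h); rewrite le_eqVlt; apply/orP; left; apply/eqP; field.
Qed.

(** With k = 2n+1 the factor 2 in the hypothesis squares delta: (3/4)^(2n+1) <= delta^2. Taking the
    square root gives (3/4)^n <= 2 delta, with room to spare for the odd exponent. *)
Lemma quarter_tail_confidence (delta : R) k : 0 < delta -> odd k ->
  2 * (ln delta^-1 / ln (4 / 3)) <= k%:R ->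
  quarter_tail k k./2.+1 <= delta / 2.
Proof.
move=> d0 ok.
have := odd_double_half k; rewrite ok add1n; set n := k./2 => <- h.
apply: le_trans (quarter_tail_half n) _.
have l0 : 0 < ln (4 / 3 : R) by rewrite ln_gt0//; lra.
have dV0 : 0 < delta^-1 by rewrite invr_gt0.
have l43 : 0 < 4 / 3 :> R by lra.
move: h; rewrite mulrA ler_pdivrMr// [2 * _]mulr_natl [_ * ln _]mulr_natl.
rewrite -(lnXn _ dV0) -(lnXn _ l43).
rewrite ler_ln ?posrE ?exprn_gt0 ?invr_gt0//; try lra.
rewrite exprVn.
have q0 : 0 < (3 / 4) ^+ n :> R by rewrite exprn_gt0.
have -> : (4 / 3) ^+ n.*2.+1 = ((3 / 4 * ((3 / 4) ^+ n) ^+ 2))^-1 :> R.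
  by rewrite -exprM muln2 -exprS -exprVn invf_div.
rewrite lef_pV2 ?posrE ?exprn_gt0 ?mulr_gt0 ?exprn_gt0// => h.
suff : (3 / 4) ^+ n / 2 <= delta by lra.
rewrite -(@ler_pXn2r _ 2) ?nnegrE ?(ltW d0) ?divr_ge0 ?(ltW q0)//.
apply: le_trans h; rewrite expr_div_n; have := exprn_gt0 2 q0; lra.
Qed.

End binomial_tail.

Section median.
Variable R : realType.
Implicit Types (s : seq R) (c : R).

(** The link from order statistics to counting: it yields both the measurability of medians and the
    reduction of a bad stage 1 median to a majority of bad blocks. *)
Lemma median_ltE s c : odd (size s) ->
  (median s < c) = ((size s)./2 < count (fun x => x < c)%R s)%N.
Proof.
move=> os; rewrite /median.
have ss : sorted <=%R (sort <=%R s) by apply: sort_sorted; exact: le_total.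
have cs : count (fun x => x < c)%R (sort <=%R s) = count (fun x => x < c)%R s.
  by apply/permP; rewrite perm_sort.
apply/idP/idP; last by rewrite -cs => h; apply: nth_count_lt.
apply: contraTT; rewrite -leqNgt -leNgt -cs => h.
apply: nth_count_ge => //; rewrite h/= size_sort.
by rewrite -[ltnRHS]odd_double_half os add1n ltnS -addnn leq_addr.
Qed.

Lemma median_gt_count s c : odd (size s) -> c < median s ->
  ((size s)./2 < count (fun x => c < x)%R s)%N.
Proof.
move=> os; apply: contraTT; rewrite -leqNgt -leNgt => h.
have ss : sorted <=%R (sort <=%R s) by apply: sort_sorted; exact: le_total.
apply: nth_count_le => //.
have -> : count (<= c) (sort <=%R s) = count (<= c) s.
  by apply/permP; rewrite perm_sort.
rewrite count_le_gt.
have h' : (count (> c) s <= (size s)./2)%N := h.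
have := odd_double_half (size s); rewrite os -addnn add1n.
by move: h'; move: (count (> c) s) (size s)./2 => a i ai <-; lia.
Qed.

(** If the median errs by more than e, then a strict majority of the entries err by more than e on
    the same side. *)
Lemma median_err_count s c e : odd (size s) -> e < `|median s - c| ->
  ((size s)./2 < count (fun x => e < `|x - c|)%R s)%N.
Proof.
move=> os; rewrite lter_normr => /orP[h|h].
  apply: leq_trans (median_gt_count os (_ : c + e < _)) _; first by lra.
  by apply: sub_count => x /= xc; rewrite lter_normr; apply/orP; left; lra.
have : median s < c - e by lra.
rewrite median_ltE// => /leq_trans; apply.
by apply: sub_count => x /= xc; rewrite lter_normr; apply/orP; right; lra.
Qed.

End median.

(** * Measurability of the two-stage algorithm *)

Section measurability.
Context d (T : measurableType d) (R : realType).

Lemma measurable_coordinate i :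
  measurable_fun [set: realseq R] (fun y : realseq R => y i).
Proof.
move=> _ B mB; rewrite setTI; apply: sub_sigma_algebra.
by exists i => //; exists B => //; rewrite setTI.
Qed.

Lemma measurable_to_realseq (f : T -> realseq R) :
  (forall i, measurable_fun [set: T] (fun w => f w i)) ->
  measurable_fun [set: T] f.
Proof.
move=> mf; apply: (@measurability _ _ T (realseq R) setT f (coordinate_sets R) erefl).
move=> _ [_ [i _ [B mB <-]] <-]; rewrite setTI.
have h := mf i measurableT B mB; rewrite setTI in h; rewrite setTI; exact h.
Qed.

Lemma measurable_fun_nat_fibers (N : T -> nat) :
  (forall n, measurable (N @^-1` [set n])) -> measurable_fun [set: T] N.
Proof.
move=> mN _ B _; rewrite setTI (_ : N @^-1` B = \bigcup_(n in B) N @^-1` [set n]).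
  by apply: bigcup_measurable.
by apply/seteqP; split => [w /= Bw|w [n Bn /= ->]//]; exists (N w).
Qed.

(** This serves the random block length: a preimage splits over the countably many values of [N]. *)
Lemma measurable_fun_select d' (T' : measurableType d') (N : T -> nat)
    (g : nat -> T -> T') :
  measurable_fun [set: T] N -> (forall n, measurable_fun [set: T] (g n)) ->
  measurable_fun [set: T] (fun w => g (N w) w).
Proof.
move=> mN mg _ B mB; rewrite setTI.
rewrite (_ : _ @^-1` B = \bigcup_n (N @^-1` [set n] `&` g n @^-1` B)).
  apply: bigcupT_measurable => n; apply: measurableI.
    by rewrite -[X in measurable X]setTI; exact: mN.
  by rewrite -[X in measurable X]setTI; exact: mg.
apply/seteqP; split => [w /= Bw|w [n _ [/= -> //]]].
by exists (N w).
Qed.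

Lemma measurable_count (B : nat -> T -> bool) k :
  (forall l, measurable_fun [set: T] (B l)) ->
  measurable_fun [set: T] (fun w => count (fun l => B l w) (iota 0 k)).
Proof.
move=> mB; elim: k => [|k IH]; first exact: measurable_cst.
under eq_fun do rewrite -addn1 iotaD count_cat.
apply: measurable_fun_addn => //=.
under eq_fun do rewrite addn0.
apply: measurable_fun_nat_fibers => n.
have mb (b : bool) : measurable (B k @^-1` [set b]).
  by rewrite -[X in measurable X]setTI; exact: mB.
rewrite (_ : _ @^-1` _ = if n == 1%N then B k @^-1` [set true] else
    if n == 0%N then B k @^-1` [set false] else set0).
  by do 2?case: ifP => // _.
apply/seteqP; split => w /=; rewrite add0n.
  by move=> <-; case Bw : (B k w).
by case: n => [|[|n]]//= ->.
Qed.

Lemma measurable_median (f : nat -> T -> R) k : odd k ->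
  (forall l, measurable_fun [set: T] (f l)) ->
  measurable_fun [set: T] (fun w => median (mkseq (fun l => f l w) k)).
Proof.
move=> ok mf mD; apply: (measurability _ (RGenInftyO.measurableE R)) => //.
move=> _ [_ [x ->] <-]; rewrite setTI.
rewrite (_ : _ @^-1` _ =
    (fun w => count (fun l => f l w < x) (iota 0 k)) @^-1` [set n | k./2 < n]%N).
  rewrite -[X in measurable X]setTI; apply: measurable_count => // l.
  by apply: measurable_fun_ltr => //; exact: measurable_cst.
apply/seteqP; split => w /=;
  rewrite in_itv/= median_ltE ?size_mkseq//= /mkseq count_map//.
Qed.

Lemma ceiln_leE (x : R) n : (ceiln x <= n)%N = (x <= n%:R).
Proof.
rewrite /ceiln -lez_nat gez0_abs ?le_max ?lexx ?orbT//.
by rewrite ge_max andbT ceil_le_int.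
Qed.

Lemma measurable_ceiln (f : T -> R) : measurable_fun [set: T] f ->
  measurable_fun [set: T] (fun w => ceiln (f w)).
Proof.
move=> mf; apply: measurable_fun_nat_fibers => n.
have mle m : measurable [set w | (ceiln (f w) <= m)%N].
  rewrite (_ : [set w | _] = f @^-1` `]-oo, m%:R]).
    by rewrite -[X in measurable X]setTI; apply: mf.
  by apply/seteqP; split => w /=; rewrite in_itv/= ceiln_leE.
case: n => [|n].
  rewrite (_ : _ @^-1` _ = [set w | (ceiln (f w) <= 0)%N])//.
  by apply/seteqP; split => w /=; rewrite leqn0 => /eqP.
rewrite (_ : _ @^-1` _ =
    [set w | (ceiln (f w) <= n.+1)%N] `\` [set w | (ceiln (f w) <= n)%N]).
  exact: measurableD.
apply/seteqP; split => w /=; first by move=> ->; rewrite leqnn ltnn.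
move=> [h /negP]; rewrite -ltnNge => h'.
by apply/eqP; rewrite eqn_leq h.
Qed.

End measurability.

Section two_stage_algorithm.
Variable R : realType.
Implicit Types (y : realseq R) (a m k : nat).

Lemma measurable_block_mean a m :
  measurable_fun [set: realseq R] (fun y : realseq R => block_mean y a m).
Proof.
apply: measurable_funM; last exact: measurable_cst.
by apply: measurable_sum => i; exact: measurable_coordinate.
Qed.

Lemma measurable_block_dev (p : R) a m :
  measurable_fun [set: realseq R] (fun y : realseq R => block_dev p y a m).
Proof.
apply: measurable_funM; last exact: measurable_cst.
apply: measurable_sum => i.
apply: (measurableT_comp (measurable_powR p)).
apply: measurableT_comp; first exact: normr_measurable.
by apply: measurable_funB; [exact: measurable_coordinate|exact: measurable_block_mean].
Qed.

Lemma measurable_stage1 k m (p : R) : odd k ->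
  measurable_fun [set: realseq R] (fun y : realseq R => stage1 k m p y).
Proof.
by move=> ok; apply: measurable_median => // l; exact: measurable_block_dev.
Qed.

Lemma measurable_stage2_size k m (p s eta : R) : odd k ->
  measurable_fun [set: realseq R] (fun y : realseq R => stage2_size k m p s eta y).
Proof.
move=> ok; apply: measurable_fun_maxn; last exact: measurable_cst.
apply: measurable_ceiln; apply: measurable_funM; first exact: measurable_cst.
apply: (measurableT_comp (measurable_powR s)).
exact: measurable_stage1.
Qed.

Lemma measurable_stage2 k k' m (p s eta : R) : odd k -> odd k' ->
  measurable_fun [set: realseq R] (fun y : realseq R => stage2 k k' m p s eta y).
Proof.
move=> ok ok'.
apply: (@measurable_fun_select _ (realseq R) _ _ (stage2_size k m p s eta) (fun n y =>
  median (mkseq (fun l => block_mean y (k * m + l * n) n) k'))) => [|n].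
  exact: measurable_stage2_size.
by apply: measurable_median => // l; exact: measurable_block_mean.
Qed.

(** The two offsets let one statement express both that a block mean reads only its own block and
    that a later block is block 0 of a shifted sequence. *)
Lemma block_mean_eq (y y' : nat -> R) a a' m :
  (forall j, (j < m)%N -> y (a + j)%N = y' (a' + j)%N) ->
  block_mean y a m = block_mean y' a' m.
Proof.
move=> yy'; rewrite /block_mean; congr (_ / _).
rewrite -{1}[a]add0n -{1}[a']add0n !big_addn !addKn.
by apply: eq_big_nat => j /andP[_ jm]; rewrite [in LHS]addnC [in RHS]addnC yy'.
Qed.

Lemma block_dev_eq (p : R) (y y' : nat -> R) a a' m :
  (forall j, (j < m)%N -> y (a + j)%N = y' (a' + j)%N) ->
  block_dev p y a m = block_dev p y' a' m.
Proof.
move=> yy'; rewrite /block_dev (block_mean_eq yy').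
move: (block_mean y' a' m) => c; congr (_ / _).
rewrite -{1}[a]add0n -{1}[a']add0n !big_addn !addKn.
by apply: eq_big_nat => j /andP[_ jm]; rewrite [in LHS]addnC [in RHS]addnC yy'.
Qed.

Lemma stage1_eq k m (p : R) (y y' : nat -> R) :
  (forall j, (j < k * m)%N -> y j = y' j) -> stage1 k m p y = stage1 k m p y'.
Proof.
move=> yy'; rewrite /stage1; congr median.
apply/eq_in_map => l; rewrite mem_iota add0n => /andP[_ lk].
apply: block_dev_eq => j jm; apply: yy'.
by apply: leq_trans (leq_mul lk (leqnn m)); rewrite mulSn addnC ltn_add2r.
Qed.

Lemma stage2_size_eq k m (p s eta : R) (y y' : nat -> R) :
  (forall j, (j < k * m)%N -> y j = y' j) ->
  stage2_size k m p s eta y = stage2_size k m p s eta y'.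
Proof. by move=> yy'; rewrite /stage2_size (stage1_eq _ yy'). Qed.

(** Truncation at the stopping index changes nothing: stage 1 reads indices below k m, so the
    truncated sequence produces the same block length N, and stage 2 reads below k m + k' N. *)
Lemma run_two_stage k k' m (p s eta : R) u y :
  @run R (two_stage k k' m p s eta) u y = stage2 k k' m p s eta y.
Proof.
rewrite /run /= /stage2 /=; set N := stage2_size k m p s eta y.
have -> : stage2_size k m p s eta (truncate (Some (k * m + k' * N)%N) y) = N.
  by apply: stage2_size_eq => j jm /=; rewrite ltn_addr.
congr median; apply/eq_in_map => l; rewrite mem_iota add0n => /andP[_ lk].
apply: block_mean_eq => j jm /=.
rewrite ifT// -addnA ltn_add2l.
by apply: leq_trans (leq_mul lk (leqnn N)); rewrite mulSn addnC ltn_add2r.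
Qed.

Lemma iid_based_two_stage k k' m (p s eta : R) (Y_ : rv_class R) :
  odd k -> odd k' -> iid_based (two_stage k k' m p s eta) Y_.
Proof.
move=> ok ok'; split.
- apply: (measurableT_comp _ (@measurable_snd _ _ _ _)).
  exact: measurable_stage2.
- move=> n.
  have mN : measurable_fun [set: unit * realseq R]
      (fun x : unit * realseq R => stage2_size k m p s eta x.2).
    apply: (measurableT_comp _ (@measurable_snd _ _ _ _)).
    exact: measurable_stage2_size.
  rewrite (_ : [set x | _] = (fun x : unit * realseq R =>
      stage2_size k m p s eta x.2) @^-1` [set j | Some (k * m + k' * j)%N = n])//.
  by rewrite -[X in measurable X]setTI; exact: mN.
- move=> i u y y' yy' /=.
  (* The rule never stops before k m, so both sides are true for i <= k m. For larger i the
     coordinates on which y and y' agree include all of stage 1, which determines the stopping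
     index. *)
  have [ikm|kmi] := leqP i (k * m)%N.
    have h n : (i <= k * m + n)%N := leq_trans ikm (leq_addr _ _).
    exact: etrans (h _) (esym (h _)).
  rewrite (@stage2_size_eq k m p s eta y y')// => j jkm.
  by apply: yy'; apply: leq_trans kmi.
- by move=> *; apply: aeW.
Qed.

End two_stage_algorithm.

(** * Independence of consecutive blocks *)

Section independence.
Context d (T : measurableType d) (R : realType) (P : probability T R).

(* A pi-lambda argument in the first of two independent events. *)
Lemma independent_of_generators d' (S : measurableType d') (G : set (set S))
    (f : T -> S) (F : set T) :
  @measurable _ S = <<s G >> -> setI_closed G ->
  measurable_fun [set: T] f -> measurable F ->
  (forall A, G A -> P (f @^-1` A `&` F) = (P (f @^-1` A) * P F)%E) ->
  forall A, measurable A -> P (f @^-1` A `&` F) = (P (f @^-1` A) * P F)%E.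
Proof.
move=> GE GI mf mF GF A; rewrite GE; move: A.
have mpre A : measurable A -> measurable (f @^-1` A).
  by move=> mA; rewrite -[X in measurable X]setTI; exact: mf.
apply: (dynkin_induction GE GI) => //.
- by rewrite preimage_setT setTI probability_setT mul1e.
- move=> S' mS' IH.
  have -> : f @^-1` (~` S') = ~` (f @^-1` S') by [].
  have mE := mpre _ mS'; move: (f @^-1` S') mE IH => E mE IH.
  have PE : P E \is a fin_num by rewrite fin_num_measure.
  have -> : P (~` E `&` F) = (P F - P (E `&` F))%E.
    by rewrite setIC -setDE measureD ?ltey_eq ?fin_num_measure// setIC.
  by rewrite probability_setC// IH muleBl ?mul1e ?fin_num_measure//.
- move=> B mB tB IH; rewrite preimage_bigcup setI_bigcupl.
  have tpre : trivIset [set: nat] (fun k => f @^-1` B k).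
    by move=> i j _ _ [w [Bi Bj]]; apply: tB => //; exists (f w); split.
  rewrite measure_bigcup//=; last 2 first.
  - by move=> k _; apply: measurableI => //; exact: mpre.
  - exact: trivIset_setIr.
  rewrite measure_bigcup//=; last by move=> k _; exact: mpre.
  have PF : P F = (fine (P F))%:E by rewrite fineK// fin_num_measure.
  rewrite [RHS]muleC PF -nneseriesZl//.
  by apply: eq_eseriesr => i _; rewrite IH -PF muleC.
Qed.

(** Independence identifies the law of the pair with the product of the laws; Tonelli's theorem is
    applied there and both integrals are pulled back to the original space. *)
Lemma ge0_integral_independent d1 d2 (S1 : measurableType d1)
    (S2 : measurableType d2) (F : T -> S1) (G : T -> S2)
    (h : S1 * S2 -> \bar R) :
  measurable_fun [set: T] F -> measurable_fun [set: T] G ->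
  (forall A B, measurable A -> measurable B ->
    P (F @^-1` A `&` G @^-1` B) = (P (F @^-1` A) * P (G @^-1` B))%E) ->
  measurable_fun [set: S1 * S2] h -> (forall x, 0 <= h x)%E ->
  (\int[P]_w h (F w, G w) = \int[P]_w \int[P]_w' h (F w, G w'))%E.
Proof.
move=> mF mG indep mh h0.
pose F' : {RV P >-> S1} := HB.pack F (isMeasurableFun.Build _ _ _ _ _ mF).
pose G' : {RV P >-> S2} := HB.pack G (isMeasurableFun.Build _ _ _ _ _ mG).
have mJ : measurable_fun [set: T] (fun w => (F w, G w)).
  exact: measurable_fun_pair.
pose J : {RV P >-> (S1 * S2)%type} :=
  HB.pack (fun w => (F w, G w)) (isMeasurableFun.Build _ _ _ _ _ mJ).
have := @ge0_integral_distribution _ _ _ _ _ P J h mh h0.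
move=> /= <-.
transitivity (\int[(distribution P F' \x distribution P G')%E]_z h z)%E.
  apply: eq_measure_integral => /= A mA _.
  by apply/esym/product_measure_unique => // B C mB mC; exact: indep.
rewrite fubini_tonelli1//= ge0_integral_distribution//=; last 2 first.
- exact: measurable_fun_fubini_tonelli_F.
- by move=> x; exact: integral_ge0.
apply: eq_integral => w _.
rewrite /fubini_F/= ge0_integral_distribution//.
exact: measurableT_comp.
Qed.

End independence.

Section initial_and_shifted_parts.
Variable R : realType.

(** Padding with 0 stays within [realseq R], so dependence on the first n coordinates becomes the
    equation [F (initial_part n y) = F y]. *)
Definition initial_part n (y : nat -> R) : realseq R :=
  fun i => if (i < n)%N then y i else 0.

Definition shifted_part n (y : nat -> R) : realseq R := fun i => y (n + i)%N.

(** Sets constraining a single coordinate are not closed under intersection. These are, and they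
    generate the same sigma-algebra, as the pi-lambda argument requires. *)
Definition cylinders : set (set (realseq R)) :=
  [set A | exists (N : nat) (C : nat -> set R), (forall i, measurable (C i)) /\
    A = [set y | forall i, (i < N)%N -> C i (y i)]].

Lemma setI_closed_cylinders : setI_closed cylinders.
Proof.
move=> _ _ [N [C [mC ->]]] [M [D [mD ->]]].
exists (maxn N M), (fun i => (if (i < N)%N then C i else setT) `&`
   (if (i < M)%N then D i else setT)); split.
  by move=> i; apply: measurableI; case: ifP.
apply/seteqP; split => y /=.
  by move=> [Cy Dy] i _; split; case: ifP => // ?; [exact: Cy|exact: Dy].
move=> CDy; split => i iN.
  by have [] := CDy i; rewrite ?leq_max ?iN.
by have [] := CDy i; rewrite ?leq_max ?iN ?orbT.
Qed.

Lemma measurable_cylinders : @measurable _ (realseq R) = <<s cylinders >>.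
Proof.
apply/seteqP; split.
  apply: smallest_sub; first exact: smallest_sigma_algebra.
  move=> _ [i _ [B mB <-]]; apply: sub_sigma_algebra.
  exists i.+1, (fun j => if j == i then B else setT); split.
    by move=> j; case: ifP.
  apply/seteqP; split => y /=.
    by move=> [_ By] j _; case: eqP => // ->.
  by move=> /(_ i (ltnSn i)); rewrite eqxx.
apply: smallest_sub; first exact: sigma_algebra_measurable.
move=> _ [N [C [mC ->]]].
rewrite (_ : [set y | _] = \bigcap_(i in [set i | (i < N)%N])
    ((fun y : realseq R => y i) @^-1` C i)); last first.
  by apply/seteqP; split => y.
apply: bigcap_measurableType => i _.
rewrite -[X in measurable X]setTI.
exact: measurable_coordinate.
Qed.

Lemma measurable_initial_part n :
  measurable_fun [set: realseq R] (initial_part n : realseq R -> realseq R).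
Proof.
apply: measurable_to_realseq => i; rewrite /initial_part.
by case: (i < n)%N; [exact: measurable_coordinate|exact: measurable_cst].
Qed.

Lemma measurable_shifted_part n :
  measurable_fun [set: realseq R] (shifted_part n : realseq R -> realseq R).
Proof. by apply: measurable_to_realseq => i; exact: measurable_coordinate. Qed.

End initial_and_shifted_parts.

Section independent_sequence.
Context d (T : measurableType d) (R : realType) (P : probability T R).
Variable X : nat -> {RV P >-> R}.

Definition independent_sequence := forall (J : seq nat) (C : nat -> set R),
  uniq J -> (forall i, measurable (C i)) ->
  (P [set w | forall i, i \in J -> C i (X i w)] = \prod_(i <- J) P (X i @^-1` C i))%E.

Definition samples (w : T) : realseq R := fun i => X i w.

Lemma measurable_samples : measurable_fun [set: T] samples.
Proof. by apply: measurable_to_realseq => i; exact: measurable_funP. Qed.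

Hypothesis indX : independent_sequence.

Lemma independent_coordinates (a n M : nat) (C D : nat -> set R) : (a <= n)%N ->
  (forall i, measurable (C i)) -> (forall i, measurable (D i)) ->
  (P ([set w | forall i, (i < a)%N -> C i (X i w)] `&`
      [set w | forall i, (i < M)%N -> D i (X (n + i)%N w)]) =
   P [set w | forall i, (i < a)%N -> C i (X i w)] *
   P [set w | forall i, (i < M)%N -> D i (X (n + i)%N w)])%E.
Proof.
move=> an mC mD.
(* One family of sets for the concatenated index list [iota 0 a ++ iota n M], which is free of
   duplicates because a <= n. *)
pose E i := if (i < n)%N then C i else D (i - n)%N.
have mE i : measurable (E i) by rewrite /E; case: ifP.
have e1 : [set w | forall i, (i < a)%N -> C i (X i w)] =
    [set w | forall i, i \in iota 0 a -> E i (X i w)].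
  apply/seteqP; split => w /= h i.
    by rewrite mem_iota/= => ia; rewrite /E (leq_trans ia an); exact: h.
  by move=> ia; have := h i; rewrite mem_iota/= /E (leq_trans ia an); exact.
have e2 : [set w | forall i, (i < M)%N -> D i (X (n + i)%N w)] =
    [set w | forall i, i \in iota n M -> E i (X i w)].
  apply/seteqP; split => w /= h i.
    rewrite mem_iota => /andP[ni iM]; rewrite /E ltnNge ni/=.
    by have := h (i - n)%N; rewrite subnKC// ltn_subLR//; exact.
  move=> iM; have := h (n + i)%N; rewrite mem_iota leq_addr ltn_add2l iM/=.
  by rewrite /E ltnNge leq_addr/= addKn; exact.
have e12 : [set w | forall i, i \in iota 0 a -> E i (X i w)] `&`
    [set w | forall i, i \in iota n M -> E i (X i w)] =
    [set w | forall i, i \in iota 0 a ++ iota n M -> E i (X i w)].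
  apply/seteqP; split => w /=.
    by move=> [h1 h2] i; rewrite mem_cat => /orP[]; [exact: h1|exact: h2].
  by move=> h; split => i hi; apply: h; rewrite mem_cat hi ?orbT.
rewrite e1 e2 e12 !indX ?iota_uniq ?big_cat//.
rewrite cat_uniq !iota_uniq andbT/=.
apply/hasPn => i; rewrite !mem_iota/= => /andP[ni _].
by rewrite -leqNgt (leq_trans an).
Qed.

(** The pi-lambda argument is run once in each factor, which reduces the claim to a pair of
    cylinders. *)
Lemma independent_initial_shifted n (A B : set (realseq R)) :
  measurable A -> measurable B ->
  (P ((initial_part n \o samples) @^-1` A `&` (shifted_part n \o samples) @^-1` B) =
   P ((initial_part n \o samples) @^-1` A) * P ((shifted_part n \o samples) @^-1` B))%E.
Proof.
move=> mA mB.
have mp : measurable_fun [set: T] (initial_part n \o samples).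
  by apply: measurableT_comp; [exact: measurable_initial_part|exact: measurable_samples].
have ms : measurable_fun [set: T] (shifted_part n \o samples).
  by apply: measurableT_comp; [exact: measurable_shifted_part|exact: measurable_samples].
have GE := measurable_cylinders R.
have mcyl D : cylinders D -> measurable (D : set (realseq R)).
  by move=> GD; rewrite GE; exact: sub_sigma_algebra.
apply: (independent_of_generators GE (@setI_closed_cylinders R) mp) => //.
  by rewrite -[X in measurable X]setTI; exact: ms.
move=> _ [N [C [mC ->]]].
rewrite setIC muleC.
apply: (independent_of_generators GE (@setI_closed_cylinders R) ms) => //.
  rewrite -[X in measurable X]setTI; apply: mp => //.
  by apply: mcyl; exists N, C.
move=> _ [M [D [mD ->]]].
rewrite setIC muleC.
(* The initial part vanishes from index n on. Either the cylinder admits 0 at all its coordinates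
   beyond n, and then only those below n constrain the samples, or its preimage is empty. *)
have [C0|] := pselect (forall i, (i < N)%N -> (n <= i)%N -> C i 0); last first.
  move=> /existsNP[i /not_implyP[iN /not_implyP[ni nC]]].
  rewrite (_ : _ @^-1` [set y | forall i, (i < N)%N -> C i (y i)] = set0).
    by rewrite set0I measure0 mul0e.
  apply/seteqP; split => w //= /(_ i iN).
  by rewrite /initial_part ltnNge ni.
rewrite (_ : (initial_part n \o samples) @^-1` _ =
    [set w | forall i, (i < minn N n)%N -> C i (X i w)]).
  by apply: independent_coordinates => //; exact: geq_minr.
apply/seteqP; split => w /= h i.
  rewrite leq_min => /andP[iN i_n]; have := h i iN.
  by rewrite /initial_part i_n.
move=> iN; rewrite /initial_part; case: ifPn => i_n.
  by apply: h; rewrite leq_min iN.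
by apply: C0 => //; rewrite leqNgt.
Qed.

(** Conditioning on the past: the value of [F] depends on the first n samples only and is frozen
    while the next one is integrated out. *)
Lemma ge0_integral_next n (F : realseq R -> R) (h : R * R -> R) :
  measurable_fun [set: realseq R] F -> (forall y, F (initial_part n y) = F y) ->
  measurable_fun [set: R * R] h -> (forall x, 0 <= h x) ->
  (\int[P]_w (h (F (samples w), X n w))%:E =
   \int[P]_w \int[P]_w' (h (F (samples w), X n w'))%:E)%E.
Proof.
move=> mF Fn mh h0.
apply: (@ge0_integral_independent _ _ _ _ _ _ _ _ (F \o samples) (X n) (EFin \o h)).
- by apply: measurableT_comp => //; exact: measurable_samples.
- exact: measurable_funP.
- move=> A B mA mB.
  have := @independent_initial_shifted n (F @^-1` A) ((fun y : realseq R => y 0%N) @^-1` B).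
  have -> : (initial_part n \o samples) @^-1` (F @^-1` A) = (F \o samples) @^-1` A.
    by apply/seteqP; split => w /=; rewrite Fn.
  have -> : (shifted_part n \o samples) @^-1` ((fun y : realseq R => y 0%N) @^-1` B) = X n @^-1` B.
    by apply/seteqP; split => w; rewrite /preimage/= /shifted_part /samples addn0.
  apply; rewrite -[X in measurable X]setTI; first exact: mF.
  exact: measurable_coordinate.
- exact/measurable_EFinP.
- by move=> x; rewrite lee_fin.
Qed.

(** The induction step for sums of samples: a bound on the inner integral for every frozen value s
    is inserted under the outer integral. *)
Lemma ge0_integral_next_le n (F : realseq R -> R) (h : R * R -> R) (g : R -> R) :
  measurable_fun [set: realseq R] F -> (forall y, F (initial_part n y) = F y) ->
  measurable_fun [set: R * R] h -> (forall x, 0 <= h x) ->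
  measurable_fun [set: R] g ->
  (forall s, \int[P]_w (h (s, X n w))%:E <= (g s)%:E)%E ->
  (\int[P]_w (h (F (samples w), X n w))%:E <= \int[P]_w (g (F (samples w)))%:E)%E.
Proof.
move=> mF Fn mh h0 mg hg; rewrite (@ge0_integral_next n F h)//.
have mFp : measurable_fun [set: T] (F \o samples).
  by apply: measurableT_comp => //; exact: measurable_samples.
have mEh : measurable_fun [set: R * R] (EFin \o h) by exact/measurable_EFinP.
have h0E x : (0 <= (EFin \o h) x)%E by rewrite lee_fin.
(* Measurability of the inner integral as a function of s is taken from Tonelli's theorem for the
   law of [X n]. *)
have mI := @measurable_fun_fubini_tonelli_F _ _ _ _ _
  (distribution P (X n)) (EFin \o h) mEh h0E.
apply: ge0_le_integral => //.
- by move=> w _; apply: integral_ge0 => w' _; rewrite lee_fin.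
- rewrite (_ : (fun w => _) = (fubini_F (distribution P (X n)) (EFin \o h)) \o (F \o samples)).
    exact: measurableT_comp.
  apply/funext => w /=; rewrite /fubini_F ge0_integral_distribution//.
  by apply: measurableT_comp => //; exact: pair1_measurable.
- apply/measurable_EFinP; exact: (measurableT_comp mg mFp).
Qed.

End independent_sequence.

(** * Deviations of one block *)

Section expectation_bounds.
Context d (T : measurableType d) (R : realType) (P : probability T R).

Lemma measurable_norm_powR d' (S : measurableType d') (g : S -> R) (r : R) :
  measurable_fun [set: S] g -> measurable_fun [set: S] (fun w => `|g w| `^ r).
Proof.
move=> mg; apply: (measurableT_comp (measurable_powR r)).
by apply: measurableT_comp => //; exact: normr_measurable.
Qed.

Lemma measurable_ge_set (g : T -> R) a : measurable_fun [set: T] g ->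
  measurable [set w | (a <= g w)%R].
Proof.
move=> mg; rewrite (_ : [set w | _] = g @^-1` `[a, +oo[).
  by rewrite -[X in measurable X]setTI; exact: mg.
by apply/seteqP; split => w /=; rewrite in_itv/= andbT.
Qed.

Lemma measurable_gt_set (g : T -> R) a : measurable_fun [set: T] g ->
  measurable [set w | (a < g w)%R].
Proof.
move=> mg; rewrite (_ : [set w | _] = g @^-1` `]a, +oo[).
  by rewrite -[X in measurable X]setTI; exact: mg.
by apply/seteqP; split => w /=; rewrite in_itv/= andbT.
Qed.

Lemma measurable_le_set (g : T -> R) a : measurable_fun [set: T] g ->
  measurable [set w | (g w <= a)%R].
Proof.
move=> mg; rewrite (_ : [set w | _] = g @^-1` `]-oo, a]).
  by rewrite -[X in measurable X]setTI; exact: mg.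
by apply/seteqP; split => w /=; rewrite in_itv/=.
Qed.

Lemma ge0_markov (g : T -> R) (a B : R) : measurable_fun [set: T] g ->
  (forall w, 0 <= g w) -> 0 < a -> (\int[P]_w (g w)%:E <= B%:E)%E ->
  (P [set w | (a <= g w)%R] <= (B / a)%:E)%E.
Proof.
move=> mg g0 a0 gB.
have := @le_integral_comp_abse _ _ _ P setT measurableT (EFin \o g) a id
  (@measurable_id _ _ _) (fun r h => h).
move=> /(_ (fun _ _ _ _ h => h)).
have mEg : measurable_fun [set: T] (EFin \o g) by exact/measurable_EFinP.
move=> /(_ mEg a0); rewrite setTI /=.
under eq_integral do rewrite ger0_norm ?g0//.
have -> : [set x | (a%:E <= `|g x|%:E)%E] = [set w | (a <= g w)%R].
  by apply/seteqP; split => w /=; rewrite ger0_norm ?lee_fin.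
have mA := measurable_ge_set a mg.
have /fineK <- : P [set w | (a <= g w)%R] \is a fin_num.
  by rewrite fin_num_measure.
rewrite -EFinM lee_fin ler_pdivlMr// mulrC -lee_fin => h.
exact: le_trans gB.
Qed.

(** [norm_powR_add_le] is integrated over W; its linear term vanishes because W is centred. This is
    the step from n to n+1 summands. *)
Lemma moment_translate_le (W : {RV P >-> R}) (r M x : R) : 1 < r -> r <= 2 ->
  P.-integrable [set: T] (EFin \o W) -> (\int[P]_w (W w)%:E = 0)%E ->
  (\int[P]_w (`|W w| `^ r)%:E <= M%:E)%E ->
  (\int[P]_w (`|x + W w| `^ r)%:E <= (`|x| `^ r + 2 `^ (2 - r) * M)%:E)%E.
Proof.
move=> r1 r2 iW W0 WM.
set a := `|x| `^ r; set b := r * (Num.sg x * `|x| `^ (r - 1)).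
set C := 2 `^ (2 - r).
have mW : measurable_fun [set: T] W by exact: measurable_funP.
have mWr := measurable_norm_powR r mW.
have iWr : P.-integrable [set: T] (fun w => (`|W w| `^ r)%:E).
  apply/integrableP; split; first exact/measurable_EFinP.
  under eq_integral do rewrite gee0_abs ?lee_fin ?powR_ge0//.
  by apply: (le_lt_trans WM); rewrite ltry.
have ibW : P.-integrable [set: T] (fun w => (b%:E * (W w)%:E)%E).
  exact: integrableZl.
have iCW : P.-integrable [set: T] (fun w => (C%:E * (`|W w| `^ r)%:E)%E).
  exact: integrableZl.
have ia : P.-integrable [set: T] (fun=> a%:E).
  exact: finite_measure_integrable_cst.
have iab : P.-integrable [set: T] (fun w => (a%:E + b%:E * (W w)%:E)%E).
  exact: integrableD.
apply: (@le_trans _ _ (\int[P]_w ((a%:E + b%:E * (W w)%:E) + C%:E * (`|W w| `^ r)%:E))%E).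
  apply: ge0_le_integral => //.
  - apply/measurable_EFinP/measurable_norm_powR.
    by apply: measurable_funD => //; exact: measurable_cst.
  - exact: measurable_int (integrableD measurableT iab iCW).
  - move=> w _; rewrite -!EFinM -!EFinD lee_fin.
    exact: norm_powR_add_le.
rewrite integralD// integralD// !integralZl// W0 mule0 adde0.
rewrite [X in (X + _)%E]integral_cst//= probability_setT mule1 EFinD leeD2l//.
by rewrite EFinM lee_wpmul2l// lee_fin powR_ge0.
Qed.

(** [expRN_le] is integrated at l|W|, then 1 + x <= e^x is applied so that the bounds for
    independent factors multiply. *)
Lemma expRN_integral_le (W : {RV P >-> R}) (r M mu l : R) : 1 <= r -> r <= 2 ->
  0 <= l ->
  (\int[P]_w `|W w|%:E = mu%:E)%E -> (\int[P]_w (`|W w| `^ r)%:E <= M%:E)%E ->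
  (\int[P]_w (expR (- (l * `|W w|)))%:E <=
   (expR (- (l * mu) + 2 `^ (1 - r) * l `^ r * M))%:E)%E.
Proof.
move=> r1 r2 l0 Wmu WM.
set C := 2 `^ (1 - r) * l `^ r.
have C0 : 0 <= C by rewrite mulr_ge0 ?powR_ge0.
have mW : measurable_fun [set: T] W by exact: measurable_funP.
have mnW : measurable_fun [set: T] (fun w => `|W w|).
  by apply: measurableT_comp => //; exact: normr_measurable.
have mWr := measurable_norm_powR r mW.
have iWr : P.-integrable [set: T] (fun w => (`|W w| `^ r)%:E).
  apply/integrableP; split; first exact/measurable_EFinP.
  under eq_integral do rewrite gee0_abs ?lee_fin ?powR_ge0//.
  by apply: (le_lt_trans WM); rewrite ltry.
have iW : P.-integrable [set: T] (fun w => `|W w|%:E).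
  apply/integrableP; split; first exact/measurable_EFinP.
  under eq_integral do rewrite gee0_abs ?lee_fin ?normr_ge0//.
  by rewrite Wmu ltry.
have ibW : P.-integrable [set: T] (fun w => ((- l)%:E * `|W w|%:E)%E).
  exact: integrableZl.
have iCW : P.-integrable [set: T] (fun w => (C%:E * (`|W w| `^ r)%:E)%E).
  exact: integrableZl.
have ia : P.-integrable [set: T] (fun=> 1%:E).
  exact: finite_measure_integrable_cst.
have iab : P.-integrable [set: T] (fun w => (1%:E + (- l)%:E * `|W w|%:E)%E).
  exact: integrableD.
apply: (@le_trans _ _ (\int[P]_w ((1%:E + (- l)%:E * `|W w|%:E) + C%:E * (`|W w| `^ r)%:E))%E).
  apply: ge0_le_integral => //.
  - apply/measurable_EFinP; apply: (measurableT_comp (@measurable_expR R)).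
    apply: measurable_funN; apply: measurable_funM => //; exact: measurable_cst.
  - exact: measurable_int (integrableD measurableT iab iCW).
  - move=> w _; rewrite -!EFinM -!EFinD lee_fin.
    rewrite /C -mulrA -powRM// mulNr.
    by apply: expRN_le => //; rewrite mulr_ge0.
rewrite integralD// integralD// !integralZl// Wmu.
rewrite [X in (X + _ + _)%E]integral_cst//= probability_setT mule1.
apply: (@le_trans _ _ (1%:E + (- l)%:E * mu%:E + C%:E * M%:E)%E).
  by rewrite leeD2l// lee_wpmul2l.
rewrite -!EFinM -!EFinD lee_fin -addrA mulNr.
exact: expR_ge1Dx.
Qed.

End expectation_bounds.

Section block_bounds.
Context d (T : measurableType d) (R : realType) (P : probability T R).
Variable X : nat -> {RV P >-> R}.
Hypothesis indX : independent_sequence X.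
Variables (r c M mu : R).
Hypotheses (r1 : 1 < r) (r2 : r <= 2).
Hypothesis iX : forall i, P.-integrable [set: T] (fun w => (X i w - c)%:E).
Hypothesis EX0 : forall i, (\int[P]_w (X i w - c)%:E = 0)%E.
Hypothesis EXr : forall i, (\int[P]_w (`|X i w - c| `^ r)%:E <= M%:E)%E.
Hypothesis EX1 : forall i, (\int[P]_w `|X i w - c|%:E = mu%:E)%E.

Let mW i : measurable_fun [set: T] (fun w => X i w - c).
Proof.
by apply: measurable_funB; [exact: measurable_funP|exact: measurable_cst].
Qed.

Let W i : {RV P >-> R} :=
  HB.pack (fun w => X i w - c) (isMeasurableFun.Build _ _ _ _ _ (@mW i)).

(* The von Bahr-Esseen inequality. *)
Lemma sum_moment_le a n :
  (\int[P]_w (`|\sum_(a <= i < a + n) (X i w - c)| `^ r)%:E <=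
   (n%:R * (2 `^ (2 - r) * M))%:E)%E.
Proof.
have r0 : 0 < r := lt_trans ltr01 r1.
elim: n => [|n IH].
  under eq_integral do rewrite addn0 big_geq// normr0 powR0 ?gt_eqF//.
  by rewrite integral0 mul0r.
pose F (y : realseq R) := \sum_(a <= i < a + n) (y i - c).
pose h (x : R * R) := `|x.1 + (x.2 - c)| `^ r.
have mF : measurable_fun [set: realseq R] F.
  apply: measurable_sum => i; apply: measurable_funB; last exact: measurable_cst.
  exact: measurable_coordinate.
under eq_integral do rewrite addnS big_nat_recr ?leq_addr//=.
pose G (x : R) : R := `|x| `^ r + 2 `^ (2 - r) * M.
apply: (@le_trans _ _ (\int[P]_w (G (F (samples X w)))%:E)%E).
  apply: (@ge0_integral_next_le _ _ _ _ X indX (a + n) F h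
    G) => //.
  - move=> y; rewrite /F; apply: eq_big_nat => i /andP[_ ia].
    by rewrite /initial_part ia.
  - apply: measurable_norm_powR; apply: measurable_funD.
      exact: measurable_fst.
    by apply: measurable_funB; [exact: measurable_snd|exact: measurable_cst].
  - by move=> x; exact: powR_ge0.
  - apply: measurable_funD; last exact: measurable_cst.
    exact: measurable_norm_powR.
  - move=> s.
    by have := @moment_translate_le _ _ _ P (W (a + n)) r M s r1 r2 (@iX _) (@EX0 _) (@EXr _).
under eq_integral do rewrite /G EFinD.
have M0 : 0 <= M.
  rewrite -lee_fin; apply: le_trans (EXr 0).
  by apply: integral_ge0 => w _; rewrite lee_fin powR_ge0.
have C0 : 0 <= 2 `^ (2 - r) * M by rewrite mulr_ge0 ?powR_ge0.
have mFr : measurable_fun [set: T] (fun w => (`|F (samples X w)| `^ r)%:E).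
  apply/measurable_EFinP/measurable_norm_powR.
  by apply: measurableT_comp => //; exact: measurable_samples.
rewrite ge0_integralD//; try by move=> w _; rewrite lee_fin ?powR_ge0.
rewrite [X in (_ + X)%E]integral_cst//= probability_setT mule1.
by rewrite -[n.+1%:R]natr1 mulrDl mul1r EFinD leeD2r.
Qed.

Lemma sum_expRN_le a n (l : R) : 0 <= l ->
  (\int[P]_w (expR (- (l * \sum_(a <= i < a + n) `|X i w - c|)))%:E <=
   (expR (n%:R * (- (l * mu) + 2 `^ (1 - r) * l `^ r * M)))%:E)%E.
Proof.
move=> l0; set b := - (l * mu) + _.
elim: n => [|n IH].
  under eq_integral do rewrite addn0 big_geq// mulr0 oppr0 expR0.
  by rewrite mul0r expR0 integral_cst//= probability_setT mul1e.
pose F (y : realseq R) := \sum_(a <= i < a + n) `|y i - c|.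
pose h (x : R * R) := expR (- (l * (x.1 + `|x.2 - c|))).
have mF : measurable_fun [set: realseq R] F.
  apply: measurable_sum => i; apply: measurableT_comp; first exact: normr_measurable.
  apply: measurable_funB; last exact: measurable_cst.
  exact: measurable_coordinate.
have mexp d' (S : measurableType d') (g : S -> R) : measurable_fun [set: S] g ->
    measurable_fun [set: S] (fun x => expR (- (l * g x))).
  move=> mg; apply: (measurableT_comp (@measurable_expR R)).
  apply: measurable_funN; apply: measurable_funM => //; exact: measurable_cst.
under eq_integral do rewrite addnS big_nat_recr ?leq_addr//=.
pose G (x : R) : R := expR (- (l * x)) * expR b.
apply: (@le_trans _ _ (\int[P]_w (G (F (samples X w)))%:E)%E).
  apply: (@ge0_integral_next_le _ _ _ _ X indX (a + n) F h
    G) => //.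
  - move=> y; rewrite /F; apply: eq_big_nat => i /andP[_ ia].
    by rewrite /initial_part ia.
  - apply: mexp; apply: measurable_funD; first exact: measurable_fst.
    apply: measurableT_comp; first exact: normr_measurable.
    by apply: measurable_funB; [exact: measurable_snd|exact: measurable_cst].
  - by move=> x; exact: expR_ge0.
  - by apply: measurable_funM; [exact: mexp|exact: measurable_cst].
  - move=> s; rewrite /h/=.
    under eq_integral do rewrite mulrDr opprD expRD EFinM.
    rewrite ge0_integralZl_EFin ?expR_ge0//; last first.
      apply/measurable_EFinP; apply: mexp.
      by apply: measurableT_comp; [exact: normr_measurable|exact: mW].
    rewrite EFinM lee_wpmul2l ?lee_fin ?expR_ge0//.
    by have := @expRN_integral_le _ _ _ P (W (a + n)) r M mu l (ltW r1) r2 l0 (@EX1 _) (@EXr _).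
under eq_integral do rewrite /G mulrC EFinM.
rewrite ge0_integralZl_EFin ?expR_ge0//; last first.
  apply/measurable_EFinP; apply: mexp.
  by apply: measurableT_comp => //; exact: measurable_samples.
rewrite -[n.+1%:R]natr1 mulrDl mul1r [_ + b]addrC [expR (b + _)]expRD [in leRHS]EFinM.
by rewrite lee_wpmul2l ?lee_fin ?expR_ge0.
Qed.

Lemma block_meanB y a n : (0 < n)%N ->
  block_mean y a n - c = (\sum_(a <= i < a + n) (y i - c)) / n%:R.
Proof.
move=> n0; rewrite /block_mean big_split/= mulrDl; congr (_ + _).
rewrite sumr_const_nat addKn mulNrn mulNr; congr (- _).
by rewrite -[c *+ n]mulr_natr mulfK// pnatr_eq0 -lt0n.
Qed.

(** Markov's inequality for the r-th power of the centred sum. The moment grows like n and the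
    threshold like n^r, which leaves n^(r-1). *)
Lemma block_mean_tail a n t : (0 < n)%N -> 0 < t ->
  (P [set w | (t < `|block_mean (samples X w) a n - c|)%R] <=
   (2 `^ (2 - r) * M / (n%:R `^ (r - 1) * t `^ r))%:E)%E.
Proof.
move=> n0 t0; have r0 : 0 < r := lt_trans ltr01 r1.
have nR : 0 < n%:R :> R by rewrite ltr0n.
pose S w := \sum_(a <= i < a + n) (X i w - c).
have mS : measurable_fun [set: T] S by apply: measurable_sum => i; exact: mW.
have mSr := measurable_norm_powR r mS.
have ntr0 : 0 < (n%:R * t) `^ r by rewrite powR_gt0 ?mulr_gt0.
have := @ge0_markov _ _ _ P (fun w => `|S w| `^ r) ((n%:R * t) `^ r) _ mSr
  (fun w => powR_ge0 _ _) ntr0 (sum_moment_le a n).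
have -> : n%:R * (2 `^ (2 - r) * M) / (n%:R * t) `^ r =
    2 `^ (2 - r) * M / (n%:R `^ (r - 1) * t `^ r).
  rewrite powRM ?ltW// -[in LHS](mulr_powRB1 (ltW nR) r0).
  by field; rewrite !gt_eqF ?powR_gt0.
apply: le_trans; apply: le_measure; rewrite ?inE.
- have mb : measurable_fun [set: T] (fun w => `|block_mean (samples X w) a n - c|).
    apply: measurableT_comp; first exact: normr_measurable.
    apply: measurable_funB; last exact: measurable_cst.
    exact: (measurableT_comp (@measurable_block_mean R a n) (measurable_samples X)).
  exact: measurable_gt_set.
- exact: measurable_ge_set.
move=> w /=; rewrite block_meanB// normrM normfV [`|n%:R|]gtr0_norm//.
rewrite ltr_pdivlMr// mulrC => /ltW h.
by apply: ge0_ler_powR => //; rewrite ?nnegrE ?mulr_ge0 ?ltW.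
Qed.

(** Chernoff's method for a lower tail, with the parameter l left free. *)
Lemma block_abs_tail a n l v : 0 <= l ->
  (P [set w | (\sum_(a <= i < a + n) `|X i w - c| <= v)%R] <=
   (expR (n%:R * (- (l * mu) + 2 `^ (1 - r) * l `^ r * M) + l * v))%:E)%E.
Proof.
move=> l0.
pose S w := \sum_(a <= i < a + n) `|X i w - c|.
have mS : measurable_fun [set: T] S.
  apply: measurable_sum => i.
  by apply: measurableT_comp; [exact: normr_measurable|exact: mW].
have mE : measurable_fun [set: T] (fun w => expR (- (l * S w))).
  apply: (measurableT_comp (@measurable_expR R)).
  apply: measurable_funN; apply: measurable_funM => //; exact: measurable_cst.
have := @ge0_markov _ _ _ P (fun w => expR (- (l * S w))) (expR (- (l * v))) _ mE
  (fun w => expR_ge0 _) (expR_gt0 _) (sum_expRN_le a n l0).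
rewrite -expRN opprK -expRD.
apply: le_trans; apply: le_measure; rewrite ?inE.
- exact: measurable_le_set.
- exact: measurable_ge_set.
by move=> w /= h; rewrite ler_expR lerN2 ler_wpM2l.
Qed.

End block_bounds.

Section single_block.
Context d (T : measurableType d) (R : realType) (P : probability T R).
Variable X : nat -> {RV P >-> R}.
Hypothesis indX : independent_sequence X.
Variables (r c M mu kappa : R).
Hypotheses (r1 : 1 < r) (r2 : r <= 2).
Hypothesis iX : forall i, P.-integrable [set: T] (fun w => (X i w - c)%:E).
Hypothesis EX0 : forall i, (\int[P]_w (X i w - c)%:E = 0)%E.
Hypothesis EXr : forall i, (\int[P]_w (`|X i w - c| `^ r)%:E <= M%:E)%E.
Hypothesis EX1 : forall i, (\int[P]_w `|X i w - c|%:E = mu%:E)%E.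
Hypotheses (kappa0 : 0 < kappa) (mu0 : 0 <= mu).
Hypothesis M_le : M <= kappa `^ (r - 1) * mu `^ r.

Let b0 : 0 < r - 1. Proof. by rewrite subr_gt0. Qed.

Let powRVK (x : R) : 0 <= x -> (x `^ (1 / (r - 1))) `^ (r - 1) = x.
Proof. by move=> x0; rewrite -powRrM div1r mulVf ?gt_eqF// powRr1. Qed.

(** Origin of 16: the (r-1)-th power of the hypothesis gives n^(r-1) >= 16 kappa^(r-1) (mu/2)^r /
    eps^r, since (1 + 1/(r-1))(r-1) = r. With the bound on M the tail is then at most 2^(2-r) 2^r /
    16 = 1/4. *)
Lemma block_mean_confidence a n eps : (0 < n)%N -> 0 < eps ->
  16 `^ (1 / (r - 1)) * kappa * eps `^ (- (1 + 1 / (r - 1))) *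
    (mu / 2) `^ (1 + 1 / (r - 1)) <= n%:R ->
  (P [set w | (eps < `|block_mean (samples X w) a n - c|)%R] <= (4^-1)%:E)%E.
Proof.
move=> n0 e0 hn.
apply: (le_trans (block_mean_tail indX r1 r2 iX EX0 EXr a n0 e0)).
have nr0 : 0 < n%:R `^ (r - 1) :> R by rewrite powR_gt0// ltr0n.
have er0 : 0 < eps `^ r by rewrite powR_gt0.
rewrite lee_fin ler_pdivrMr ?mulr_gt0//.
have sr : (1 + 1 / (r - 1)) * (r - 1) = r by field; rewrite gt_eqF.
have := ge0_ler_powR (ltW b0) _ _ hn.
rewrite !nnegrE ler0n !mulr_ge0 ?powR_ge0 ?(ltW kappa0)// => /(_ isT isT).
rewrite !powRM ?mulr_ge0 ?powR_ge0 ?(ltW kappa0)// powRVK//.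
rewrite -!powRrM mulNr sr powRN => h.
have h2 : 16 * kappa `^ (r - 1) * (mu `^ r * 2^-1 `^ r) <= n%:R `^ (r - 1) * eps `^ r.
  rewrite -ler_pdivrMr//; apply: le_trans h.
  by rewrite mulrAC.
have -> : 2 `^ (2 - r) = 4 * 2^-1 `^ r :> R.
  rewrite powRD ?pnatr_eq0 ?implybT// powR_mulrn// -powR_inv1// -powRrM.
  by rewrite mulN1r expr2; congr (_ * _); ring.
have p0 : 0 <= 2^-1 `^ r :> R := powR_ge0 _ _.
have h3 := ler_wpM2l p0 M_le.
by lra.
Qed.

Lemma block_dev_confidence a m :
  3 * 48 `^ (1 / (r - 1)) * kappa <= m%:R ->
  (P [set w | (block_dev 1 (samples X w) a m < mu / 2)%R] <= (4^-1)%:E)%E.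
Proof.
move=> hm; have b1 : r - 1 <= 1 by rewrite lerBlDr; exact: r2.
have m0 : (0 < m)%N.
  rewrite -(ltr_nat R); apply: lt_le_trans hm.
  by rewrite !mulr_gt0// powR_gt0.
have mR : 0 < m%:R :> R by rewrite ltr0n.
(* For mu = 0 a nonnegative deviation cannot fall below mu/2; otherwise the Laplace parameter below
   may be divided by mu. *)
have [->|mu_neq0] := eqVneq mu 0.
  rewrite mul0r (_ : [set w | _] = set0) ?measure0 ?lee_fin ?invr_ge0//.
  apply/seteqP; split => w //=; rewrite ltNge => /negP; apply.
  by rewrite divr_ge0// sumr_ge0// => i _; rewrite powR_ge0.
have mup : 0 < mu by rewrite lt0r mu_neq0.
have mr0 : 0 < m%:R `^ (r - 1) :> R by rewrite powR_gt0.
have mpow : 3 `^ (r - 1) * 48 * kappa `^ (r - 1) <= m%:R `^ (r - 1).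
  have := ge0_ler_powR (ltW b0) _ _ hm.
  rewrite !nnegrE ler0n !mulr_ge0 ?powR_ge0 ?(ltW kappa0)// => /(_ isT isT).
  by rewrite !powRM ?mulr_ge0 ?powR_ge0 ?(ltW kappa0)// powRVK.
pose S w := \sum_(a <= i < a + m) `|X i w - c|.
have mS : measurable_fun [set: T] S.
  apply: measurable_sum => i; apply: measurableT_comp; first exact: normr_measurable.
  by apply: measurable_funB; [exact: measurable_funP|exact: measurable_cst].
have mB : measurable_fun [set: T] (fun w => `|block_mean (samples X w) a m - c|).
  apply: measurableT_comp; first exact: normr_measurable.
  apply: measurable_funB; last exact: measurable_cst.
  exact: (measurableT_comp (@measurable_block_mean R a m) (measurable_samples X)).
(* With this l the term 2^(1-r) l^r M of the exponent is at most l mu / 8. *)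
pose l := 2 / (mu * kappa) * 8^-1 `^ (1 / (r - 1)).
have mk0 : 0 < mu * kappa by rewrite mulr_gt0.
have l0 : 0 < l by rewrite mulr_gt0 ?divr_gt0 ?powR_gt0 ?invr_gt0.
have mup4 : 0 < mu / 4 by rewrite divr_gt0.
have A_le := block_abs_tail indX r1 r2 EXr EX1 a m (3 / 4 * (m%:R * mu)) (ltW l0).
have B_le := block_mean_tail indX r1 r2 iX EX0 EXr a m0 mup4.
apply: (@le_trans _ _ ((12^-1)%:E + (6^-1)%:E)%E); last first.
  by rewrite -EFinD lee_fin; lra.
apply: (@le_trans _ _ (P [set w | (S w <= 3 / 4 * (m%:R * mu))%R] +
    P [set w | (mu / 4 < `|block_mean (samples X w) a m - c|)%R])%E).
  apply: (le_trans _ (measureU2 _ _ _)); last 2 first.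
  - exact: measurable_le_set.
  - exact: measurable_gt_set.
  apply: le_measure; rewrite ?inE.
  - rewrite (_ : [set w | _] = (fun w => block_dev 1 (samples X w) a m) @^-1` `]-oo, mu / 2[).
      rewrite -[X in measurable X]setTI.
      exact: (measurableT_comp (@measurable_block_dev R 1 a m) (measurable_samples X)).
    by apply/seteqP; split => w /=; rewrite in_itv/=.
  - apply: measurableU; [exact: measurable_le_set|exact: measurable_gt_set].
  move=> w /=; rewrite /block_dev => hdev.
  have [|hB] := ltP (mu / 4) `|block_mean (samples X w) a m - c|; first by right.
  left; move: hdev; rewrite ltr_pdivrMr//.
  (* Each |X i - c| exceeds the distance of X i to the block mean by at most the error of that mean,
     here at most mu/4. A deviation below mu/2 thus forces the sum below (3/4) m mu. *)
  suff : S w - m%:R * (mu / 4) <=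
      \sum_(a <= i < a + m) `|samples X w i - block_mean (samples X w) a m| `^ 1 by lra.
  have -> : m%:R * (mu / 4) = \sum_(a <= i < a + m) mu / 4.
    by rewrite sumr_const_nat addKn mulr_natl.
  rewrite /S -sumrB; apply: ler_sum => i _; rewrite powRr1// lerBlDr.
  rewrite -(subrK (block_mean (samples X w) a m) (X i w)) -addrA.
  by apply: le_trans (ler_normD _ _) _; rewrite lerD2l.
apply: leeD.
  apply: (le_trans A_le); rewrite lee_fin.
  have key : 2 `^ (1 - r) * l `^ r * M <= l * mu / 8.
    (* In this form the choice of l is visible: (l/2)^(r-1) = 1/(8 (mu kappa)^(r-1)), and M is at
       most kappa^(r-1) mu^r. *)
    have -> : 2 `^ (1 - r) * l `^ r = l * (l / 2) `^ (r - 1).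
      rewrite -(mulr_powRB1 (ltW l0) (lt_trans ltr01 r1)).
      rewrite (@powRM _ l 2^-1) ?invr_ge0 ?(ltW l0)//.
      have -> : 2^-1 `^ (r - 1) = 2 `^ (1 - r) :> R.
        by rewrite -(powR_inv1 (_ : 0 <= 2))// -powRrM; congr (_ `^ _); ring.
      by ring.
    have -> : l / 2 = (mu * kappa)^-1 * 8^-1 `^ (1 / (r - 1)).
      by rewrite /l; field; rewrite !gt_eqF.
    rewrite powRM ?invr_ge0 ?(ltW mk0) ?powR_ge0// powRVK ?invr_ge0//.
    have -> : (mu * kappa)^-1 `^ (r - 1) = (mu `^ (r - 1) * kappa `^ (r - 1))^-1.
      by rewrite -(powR_inv1 (ltW mk0)) -powRrM mulN1r powRN powRM ?ltW.
    set A := mu `^ (r - 1) * kappa `^ (r - 1).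
    have A0 : 0 < A by rewrite mulr_gt0 ?powR_gt0.
    rewrite (_ : l * (A^-1 / 8) * M = l / 8 * (M / A)); last by ring.
    rewrite (_ : l * mu / 8 = l / 8 * mu); last by ring.
    rewrite ler_pM2l ?divr_gt0// ler_pdivrMr// /A mulrA mulr_powRB1 ?(lt_trans ltr01 r1)//.
    by rewrite mulrC.
  (* Per sample the exponent is at most l mu (-1 + 1/8 + 3/4) = -l mu/8. The hypothesis on m turns
     the total into at least 3 (48/8)^(1/(r-1)) / 4 in absolute value, and 6^(1/(r-1)) >= 6 as r <=
     2. *)
  have hl : 6 * 3 / 4 <= m%:R * (l * mu / 8).
    have -> : l * mu / 8 = 8^-1 `^ (1 / (r - 1)) / (4 * kappa).
      by rewrite /l; field; rewrite !gt_eqF.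
    rewrite mulrA ler_pdivlMr ?mulr_gt0//.
    have p8 : 0 <= 8^-1 `^ (1 / (r - 1)) :> R := powR_ge0 _ _.
    have := ler_wpM2r p8 hm.
    have -> : 3 * 48 `^ (1 / (r - 1)) * kappa * 8^-1 `^ (1 / (r - 1)) =
        3 * kappa * (48 * 8^-1) `^ (1 / (r - 1)).
      by rewrite powRM ?invr_ge0//; ring.
    have -> : 48 * 8^-1 = 6 :> R by field.
    have h6 : 6 <= 6 `^ (1 / (r - 1)) :> R.
      rewrite -[leLHS](powRr1 (_ : 0 <= 6))//; apply: ler_powR; first by lra.
      by rewrite ler_pdivlMr// mul1r.
    have := ler_wpM2l (ltW kappa0) h6; lra.
  (* The exponent -9/2 is split so that e^(9/2) = (e^(3/2))^3 >= (5/2)^3 > 12. *)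
  apply: (@le_trans _ _ (expR (- (3 * (3 / 2))))).
    rewrite ler_expR.
    have := ler_wpM2l (ltW mR) key; lra.
  rewrite expRN lef_pV2 ?posrE ?expR_gt0// expRM_natl.
  have h := expR_ge1Dx (3 / 2 : R).
  have h' : (5 / 2) ^+ 3 <= expR (3 / 2) ^+ 3 :> R.
    by apply: lerXn2r; rewrite ?nnegrE ?expR_ge0//; lra.
  apply: le_trans h'; rewrite !exprS expr0; lra.
apply: (le_trans B_le); rewrite lee_fin ler_pdivrMr ?mulr_gt0 ?powR_gt0//.
(* With [mpow] the tail at mu/4 is at most 8u/(48v) = (1/6)(u/v), and u <= v. This is where 48 = 6 *
   8 comes from. *)
set u := 2 `^ (r - 1) : R; set v := 3 `^ (r - 1) : R in mpow.
have u0 : 0 < u by rewrite powR_gt0.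
have uv : u <= v by apply: ge0_ler_powR => //; rewrite ?nnegrE ?ltW//; lra.
have -> : 2 `^ (2 - r) = 2 / u.
  rewrite (_ : 2 - r = 1 - (r - 1)); last by ring.
  by rewrite powRB ?pnatr_eq0 ?implybT// powRr1.
have -> : (mu / 4) `^ r = mu `^ r / (4 * u * u).
  rewrite powRM ?invr_ge0// (_ : 4^-1 = 2^-1 * 2^-1 :> R); last by field.
  rewrite powRM ?invr_ge0// -powR_inv1// -powRrM mulN1r powRN.
  rewrite -(mulr_powRB1 (_ : 0 <= 2) (lt_trans ltr01 r1))// -/u.
  by field; rewrite gt_eqF.
have mur : 0 < mu `^ r by rewrite powR_gt0.
have kr : 0 < kappa `^ (r - 1) by rewrite powR_gt0.
rewrite mulrAC ler_pdivrMr//.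
have -> : 6^-1 * (m%:R `^ (r - 1) * (mu `^ r / (4 * u * u))) * u =
   m%:R `^ (r - 1) * mu `^ r / (24 * u) by field; rewrite gt_eqF.
rewrite ler_pdivlMr ?mulr_gt0//.
have h1 := ler_wpM2r (ltW mur) mpow.
apply: le_trans h1.
have h2 : 2 * M * (24 * u) <= 2 * (kappa `^ (r - 1) * mu `^ r) * (24 * u).
  by rewrite ler_pM2r ?mulr_gt0// ler_pM2l.
apply: (le_trans h2).
have h3 := ler_wpM2l (ltW (mulr_gt0 kr mur)) uv.
lra.
Qed.

End single_block.

(** * Majorities of blocks and random block lengths *)

Section amplification.
Context d (T : measurableType d) (R : realType) (P : probability T R).
Variable X : nat -> {RV P >-> R}.
Hypothesis indX : independent_sequence X.

(** At least h+1 of k+1 blocks are bad when this holds among the first k already, with probability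
    e, or when exactly h of those are bad, with probability d, and the independent last block is bad
    too, with probability f <= 1/4. Then e + d f <= (1/4)(e + d) + (3/4) e, which is the recursion
    of [quarter_tail]. *)
Lemma majority_of_blocks (Bad : realseq R -> bool) a m k h :
  measurable_fun [set: realseq R] Bad ->
  (forall y y' : realseq R, (forall j, (j < m)%N -> y j = y' j) -> Bad y = Bad y') ->
  (forall l, P [set w | Bad (shifted_part (a + l * m) (samples X w))] <= (4^-1)%:E)%E ->
  (P [set w | (h <= count (fun l => Bad (shifted_part (a + l * m) (samples X w)))
     (iota 0 k))%N] <= (quarter_tail R k h)%:E)%E.
Proof.
move=> mBad Badm P4.
pose B l y := Bad (shifted_part (a + l * m) y).
have mBl l : measurable_fun [set: realseq R] (B l : realseq R -> bool).
  exact: (measurableT_comp mBad (measurable_shifted_part _)).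
pose cnt k' (y : realseq R) := count (fun l => B l y) (iota 0 k').
have mcnt k' : measurable_fun [set: realseq R] (cnt k') by exact: measurable_count.
have mcntT k' : measurable_fun [set: T] (cnt k' \o samples X).
  by apply: measurableT_comp => //; exact: measurable_samples.
have mset k' (C : set nat) : measurable [set w | C (cnt k' (samples X w))].
  by rewrite -[X in measurable X]setTI; exact: (mcntT k').
have mbad l : measurable [set w | B l (samples X w)].
  rewrite (_ : [set w | _] = (B l \o samples X) @^-1` [set true]); last first.
    by apply/seteqP; split => w /=; case: (B l _).
  rewrite -[X in measurable X]setTI.
  by apply: (measurableT_comp (mBl l) (measurable_samples X)).
change (P [set w | (h <= cnt k (samples X w))%N] <= (quarter_tail R k h)%:E)%E.
elim: k h => [|k IH] [|h].
- by rewrite (_ : [set w | _] = setT) ?probability_setT//; apply/seteqP; split.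
- by rewrite (_ : [set w | _] = set0) ?measure0//; apply/seteqP; split.
- by rewrite quarter_tail0; apply: probability_le1; exact: (mset _ [set n | (0 <= n)%N]).
have cntS y : cnt k.+1 y = (cnt k y + B k y)%N.
  by rewrite /cnt -addn1 iotaD count_cat/= addn0.
pose E2 := [set w | (h < cnt k (samples X w))%N].
pose D := [set w | cnt k (samples X w) = h].
pose F := [set w | B k (samples X w)].
have mE2 : measurable E2 by exact: (mset _ [set n | (h < n)%N]).
have mD : measurable D by exact: (mset _ [set n | n = h]).
have mF : measurable F := mbad k.
have -> : [set w | (h < cnt k.+1 (samples X w))%N] = E2 `|` (D `&` F).
  apply/seteqP; split => w /=; rewrite cntS.
    have [hlt|hgt|hE] := ltngtP h (cnt k (samples X w)); first by left.
      by case: (B k _) => /=; rewrite ?addn1 ?addn0; lia.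
    case BE : (B k _) => /=; last by rewrite hE addn0 ltnn.
    by right; split.
  by move=> [|[/= -> ->]]; [rewrite /E2/=; lia|rewrite addn1].
have -> : P (E2 `|` (D `&` F)) = (P E2 + P (D `&` F))%E.
  rewrite measureU//; first exact: measurableI.
  apply/seteqP; split => w //=; rewrite /E2/D/=.
  by move=> [h1 [h2 _]]; move: h1; rewrite h2 ltnn.
have indDF : P (D `&` F) = (P D * P F)%E.
  have := @independent_initial_shifted _ _ _ P X indX (a + k * m)
    (cnt k @^-1` [set h]) [set y | Bad y].
  have -> : (initial_part (a + k * m) \o samples X) @^-1` (cnt k @^-1` [set h]) = D.
    apply/seteqP; split => w /=; rewrite /D/=.
      move=> <-; apply/eq_in_count => l; rewrite mem_iota add0n => /andP[_ lk].
      apply: Badm => j jm; rewrite /shifted_part /initial_part -addnA ltn_add2l.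
      by rewrite ifT//; apply: leq_trans (leq_mul lk (leqnn m)); rewrite mulSn addnC ltn_add2r.
    move=> <-; apply/eq_in_count => l; rewrite mem_iota add0n => /andP[_ lk].
    apply: Badm => j jm; rewrite /shifted_part /initial_part -addnA ltn_add2l.
    by rewrite ifT//; apply: leq_trans (leq_mul lk (leqnn m)); rewrite mulSn addnC ltn_add2r.
  apply.
    by rewrite -[X in measurable X]setTI; exact: (mcnt k).
  rewrite (_ : [set y | _] = Bad @^-1` [set true]); last first.
    by apply/seteqP; split => w /=; case: (Bad _).
  by rewrite -[X in measurable X]setTI; exact: mBad.
have E1D : P [set w | (h <= cnt k (samples X w))%N] = (P E2 + P D)%E.
  rewrite -measureU//.
    congr (P _); apply/seteqP; split => w; rewrite /E2 /D/=.
      by move=> hle; have [?|?|<-] := ltngtP h (cnt k (samples X w)); [left|lia|right].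
    by move=> [/ltnW|->].
  by apply/seteqP; split => w //=; rewrite /E2/D/= => -[+ h2]; rewrite h2 ltnn.
have := IH h; rewrite E1D; have := IH h.+1; rewrite -/E2.
have PE A : measurable A -> P A = (fine (P A))%:E.
  by move=> mA; rewrite fineK// fin_num_measure.
have P4k := P4 k; rewrite -/F in P4k.
rewrite indDF; move: P4k.
have D0 : (0 <= P D)%E by exact: measure_ge0.
move: D0; rewrite (PE _ mE2) (PE _ mD) (PE _ mF).
rewrite -EFinM -!EFinD !lee_fin /=.
move: (fine _) (fine _) (fine _) => e d0 f d00 f4 he hd.
have := ler_wpM2l d00 f4; lra.
Qed.

(** The event is split over the values n of [N]. The event N = n depends on the first n0 samples and
    [F n] on the later ones, so each admissible piece has probability at most q P(N = n). *)
Lemma random_index_le n0 (N : realseq R -> nat) (C : nat -> Prop)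
    (F : nat -> set (realseq R)) (q : R) :
  measurable_fun [set: realseq R] N ->
  (forall y, N (initial_part n0 y) = N y) ->
  (forall n, measurable (F n)) ->
  (forall n, C n -> P ((shifted_part n0 \o samples X) @^-1` F n) <= q%:E)%E ->
  0 <= q ->
  (P [set w | C (N (samples X w)) /\
     F (N (samples X w)) (shifted_part n0 (samples X w))] <= q%:E)%E.
Proof.
move=> mN N0 mF Fq q0.
pose Nn n := [set w | N (samples X w) = n].
have mNn n : measurable (Nn n).
  rewrite (_ : Nn n = (N \o samples X) @^-1` [set n])//.
  rewrite -[X in measurable X]setTI.
  exact: (measurableT_comp mN (measurable_samples X)).
have mFn n : measurable ((shifted_part n0 \o samples X) @^-1` F n).
  rewrite -[X in measurable X]setTI.
  by apply: (measurableT_comp (measurable_shifted_part n0) (measurable_samples X)).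
pose G n := if `[< C n >] then Nn n `&` (shifted_part n0 \o samples X) @^-1` F n else set0.
have mG n : measurable (G n).
  by rewrite /G; case: ifP => // _; exact: measurableI.
have tN : trivIset [set: nat] Nn.
  by move=> i j _ _ [w [<- <-]].
have GN n : G n `<=` Nn n.
  by rewrite /G; case: ifP => // _ w [].
have -> : [set w | C (N (samples X w)) /\
     F (N (samples X w)) (shifted_part n0 (samples X w))] = \bigcup_n G n.
  apply/seteqP; split => w.
    by move=> [Cw Fw]; exists (N (samples X w)) => //; rewrite /G asboolT.
  move=> [n _]; rewrite /G; case: ifPn => // /asboolP Cn.
  by rewrite /Nn => -[/= Nw Fw]; rewrite Nw.
have tG : trivIset [set: nat] G.
  by move=> i j _ _ [w [/GN wi /GN wj]]; apply: tN => //; exists w.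
rewrite measure_bigcup//.
apply: (@le_trans _ _ (\sum_(0 <= i <oo | i \in [set: nat]) (q%:E * P (Nn i)))%E).
  apply: lee_nneseries => [*|n _]; first exact: measure_ge0.
  rewrite /G; case: ifPn => [/asboolP Cn|_]; last first.
    by rewrite measure0 mule_ge0// ?lee_fin.
  rewrite [leLHS](_ : _ = (P (Nn n) * P ((shifted_part n0 \o samples X) @^-1` F n))%E); last first.
    have := @independent_initial_shifted _ _ _ P X indX n0 (N @^-1` [set n]) (F n).
    have -> : (initial_part n0 \o samples X) @^-1` (N @^-1` [set n]) = Nn n.
      by apply/seteqP; split => w /=; rewrite /Nn/= N0.
    apply => //; rewrite -[X in measurable X]setTI; exact: mN.
  by rewrite muleC lee_wpmul2r ?measure_ge0// Fq.
rewrite nneseriesZl; last by move=> i _; exact: measure_ge0.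
rewrite -measure_bigcup//.
rewrite -[leRHS]mule1 lee_wpmul2l ?lee_fin//.
by apply: probability_le1; exact: bigcup_measurable.
Qed.

End amplification.

(** * Central moments in the class *)

Section moments.
Context d (T : measurableType d) (R : realType) (P : probability T R).
Implicit Types (Z : T -> R) (a B K m p q r t : R).

Lemma Lfun_centered (Y : {RV P >-> R}) (q : \bar R) c : (1%:E <= q)%E ->
  (Y : T -> R) \in Lfun P q -> (fun w => Y w - c) \in Lfun P q.
Proof.
move=> q1; rewrite !inE/= => /andP[_ /[!inE] Yq].
have mY : measurable_fun [set: T] Y by exact: measurable_funP.
apply/andP; split; rewrite inE/=.
  by apply: measurable_funB => //; exact: measurable_cst.
rewrite /finite_norm.
apply: (le_lt_trans (@eminkowski _ _ _ P Y (cst (- c)) q mY (measurable_cst _) q1)).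
apply: lte_add_pinfty => //.
move: q1 {Yq}; case: q => [q _| _|//].
  have := @Lfun_cst _ _ _ P (- c) q; rewrite inE/= => /andP[_ /[!inE]].
  exact.
rewrite unlock; case: ifPn => // P0.
rewrite (_ : abse \o _ = cst `|- c|%:E)//.
by rewrite ess_sup_cst// ltry.
Qed.

Lemma LnormE Z q m : (\int[P]_w (`|Z w| `^ q)%:E = m%:E)%E ->
  Lnorm P q%:E (EFin \o Z) = (m `^ q^-1)%:E.
Proof. by move=> Zm; rewrite unlock /= -poweR_EFin -Zm. Qed.

Lemma Lfun_moment Z q : 1 <= q -> Z \in Lfun P q%:E ->
  exists2 m, 0 <= m & (\int[P]_w (`|Z w| `^ q)%:E = m%:E)%E.
Proof.
move=> q1 /(Lfun_integrable q1) /integrableP[_].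
under eq_integral do rewrite gee0_abs ?lee_fin ?powR_ge0//.
move=> Zoo; exists (fine (\int[P]_w (`|Z w| `^ q)%:E)%E).
  by apply/fine_ge0/integral_ge0 => w _; rewrite lee_fin powR_ge0.
rewrite fineK// ge0_fin_numE//.
by apply/integral_ge0 => w _; rewrite lee_fin powR_ge0.
Qed.

(* Lyapunov's inequality; after normalisation it is the integral of the
   weighted arithmetic-geometric mean inequality. *)
Lemma moment_interpolation Z q t a B : measurable_fun [set: T] Z ->
  1 < q -> 1 <= t -> t <= q -> 0 < a -> 0 < B ->
  (\int[P]_w `|Z w|%:E = a%:E)%E -> (\int[P]_w (`|Z w| `^ q)%:E <= B%:E)%E ->
  (\int[P]_w (`|Z w| `^ t)%:E <=
   (a `^ ((q - t) / (q - 1)) * B `^ ((t - 1) / (q - 1)))%:E)%E.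
Proof.
move=> mZ q1 t1 tq a0 B0 Za ZB.
have q10 : 0 < q - 1 by rewrite subr_gt0.
move: t1; rewrite le_eqVlt => /predU1P[<-|t1].
  rewrite subrr mul0r powRr0 mulr1 divff ?gt_eqF// powRr1 ?(ltW a0)//.
  by under eq_integral do rewrite powRr1//; rewrite Za.
move: tq; rewrite le_eqVlt => /predU1P[->|tq].
  by rewrite subrr mul0r powRr0 mul1r divff ?gt_eqF// powRr1 ?(ltW B0).
set th := (q - t) / (q - 1).
have th0 : 0 < th by rewrite divr_gt0// subr_gt0.
have th1 : th < 1 by rewrite ltr_pdivrMr// mul1r ltrD2l ltrN2.
have -> : (t - 1) / (q - 1) = 1 - th by rewrite /th; field; rewrite gt_eqF.
set A := _ * _.
have A0 : 0 < A by rewrite mulr_gt0 ?powR_gt0.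
have th1' : 0 <= 1 - th by rewrite subr_ge0 ltW.
have mZ1 : measurable_fun [set: T] (fun w => `|Z w|%:E).
  by apply/measurable_EFinP; apply: measurableT_comp => //; exact: normr_measurable.
have mZr r : measurable_fun [set: T] (fun w => (`|Z w| `^ r)%:E).
  by apply/measurable_EFinP; exact: measurable_norm_powR.
have c1 : 0 <= A * th / a := divr_ge0 (mulr_ge0 (ltW A0) (ltW th0)) (ltW a0).
have c2 : 0 <= A * (1 - th) / B := divr_ge0 (mulr_ge0 (ltW A0) th1') (ltW B0).
apply: (@le_trans _ _ (\int[P]_w ((A * th / a)%:E * `|Z w|%:E +
   (A * (1 - th) / B)%:E * (`|Z w| `^ q)%:E))%E).
  apply: ge0_le_integral => //.
  - by apply: emeasurable_funD; apply: measurable_funeM.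
  move=> w _; rewrite -!EFinM -EFinD lee_fin.
  have x0 : 0 <= `|Z w| by [].
  move: (`|Z w|) x0 => x x0.
  have := powR_weighted_amgm th0 th1 (divr_ge0 x0 (ltW a0))
    (divr_ge0 (powR_ge0 x q) (ltW B0)).
  move=> /(ler_wpM2l (ltW A0)).
  have -> : A * ((x / a) `^ th * (x `^ q / B) `^ (1 - th)) = x `^ t.
    rewrite !powRM ?invr_ge0 ?powR_ge0 ?(ltW a0) ?(ltW B0)//.
    rewrite -(powR_inv1 (ltW a0)) -(powR_inv1 (ltW B0)) -!powRrM !mulN1r !powRN.
    have -> : A * (x `^ th / a `^ th * (x `^ (q * (1 - th)) / B `^ (1 - th))) =
        x `^ th * x `^ (q * (1 - th)).
      by rewrite /A; field; rewrite !gt_eqF ?powR_gt0.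
    have tE : th + q * (1 - th) = t by rewrite /th; field; rewrite gt_eqF.
    by rewrite -powRD tE// gt_eqF//= (lt_trans ltr01).
  by move=> h; apply: (le_trans h); rewrite le_eqVlt; apply/orP; left; apply/eqP; ring.
rewrite ge0_integralD//; last 4 first.
- by move=> w _; rewrite mule_ge0// lee_fin.
- exact: measurable_funeM.
- by move=> w _; rewrite mule_ge0// lee_fin powR_ge0.
- exact: measurable_funeM.
rewrite !ge0_integralZl_EFin// Za.
apply: (@le_trans _ _ ((A * th / a)%:E * a%:E + (A * (1 - th) / B)%:E * B%:E)%E).
  by rewrite leeD2l// lee_wpmul2l// lee_fin.
rewrite -!EFinM -EFinD lee_fin !divfK ?gt_eqF//.
by rewrite -mulrDr [th + _]addrC subrK mulr1.
Qed.

(** Origin of the exponent pq/(q-p): Lyapunov's inequality bounds mp by a and mq, the class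
    condition bounds mq by mp. In logarithms both are linear, and eliminating mp isolates ln mq. *)
Lemma moment_comparison p q K a mp mq : 1 <= p -> p < q -> 0 < K -> 0 < a ->
  0 <= mp -> 0 <= mq ->
  (0 < mq -> mp <= a `^ ((q - p) / (q - 1)) * mq `^ ((p - 1) / (q - 1))) ->
  mq `^ q^-1 <= K * mp `^ p^-1 ->
  mq <= (K `^ (p * q / (q - p))) `^ (q - 1) * a `^ q.
Proof.
move=> p1 pq K0 a0 mp0; rewrite le_eqVlt => /predU1P[<- _ _|mq0 /(_ mq0) h1 h2].
  by rewrite mulr_ge0 ?powR_ge0.
have p0 : 0 < p := lt_le_trans ltr01 p1.
have q0 : 0 < q := lt_trans p0 pq.
have q10 : 0 < q - 1 by rewrite subr_gt0 (le_lt_trans p1).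
have qp0 : 0 < q - p by rewrite subr_gt0.
have {}mp0 : 0 < mp.
  rewrite lt0r mp0 andbT; apply/eqP => mpE; move: h2.
  by rewrite mpE powR0 ?invr_neq0 ?gt_eqF// mulr0 leNgt powR_gt0.
have pos1 : 0 < mq `^ q^-1 by rewrite powR_gt0.
have pos2 : 0 < mp `^ p^-1 by rewrite powR_gt0.
have pos3 : 0 < a `^ ((q - p) / (q - 1)) by rewrite powR_gt0.
have pos4 : 0 < mq `^ ((p - 1) / (q - 1)) by rewrite powR_gt0.
have pos5 : 0 < (K `^ (p * q / (q - p))) `^ (q - 1) by rewrite !powR_gt0.
have pos6 : 0 < a `^ q by rewrite powR_gt0.
move: h1 h2; rewrite -ler_ln ?posrE ?mulr_gt0// lnM ?posrE// !ln_powR => h1.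
rewrite -ler_ln ?posrE ?mulr_gt0// lnM ?posrE// !ln_powR => h2.
rewrite -ler_ln ?posrE ?mulr_gt0// lnM ?posrE// !ln_powR.
move: h1 h2; move: (ln mq) (ln mp) (ln K) (ln a) => x y k al h1 h2.
(* After elimination ln mq stands on both sides with coefficients 1/q and (p-1)/(p(q-1)). Their
   difference is the reciprocal of this multiplier. *)
have c0 : 0 <= p * q * (q - 1) / (q - p) by rewrite divr_ge0 ?mulr_ge0 ?ltW.
have pV0 : 0 <= p^-1 by rewrite invr_ge0 ltW.
have h3 := ler_wpM2l c0 (le_trans h2 (lerD (lexx k) (ler_wpM2l pV0 h1))).
have e1 : p * q * (q - 1) / (q - p) * (q^-1 * x) = p * (q - 1) / (q - p) * x.
  by field; rewrite !gt_eqF.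
have e2 : p * q * (q - 1) / (q - p) *
   (k + p^-1 * ((q - p) / (q - 1) * al + (p - 1) / (q - 1) * x)) =
   (q - 1) * (p * q / (q - p) * k) + q * al + q * (p - 1) / (q - p) * x.
  by field; rewrite !gt_eqF.
have e3 : p * (q - 1) / (q - p) * x = x + q * (p - 1) / (q - p) * x.
  by field; rewrite !gt_eqF.
by move: h3; rewrite e1 e2 e3 lerD2r.
Qed.

Lemma ae_eq0_moment Z t : measurable_fun [set: T] Z -> 0 < t ->
  (\int[P]_w `|Z w|%:E = 0)%E -> (\int[P]_w (`|Z w| `^ t)%:E = 0)%E.
Proof.
move=> mZ t0 Z0.
have mZ1 : measurable_fun [set: T] (fun w => (Z w)%:E) by exact/measurable_EFinP.
have /(ae_eq_integral_abs P measurableT mZ1) Zae : (\int[P]_w `|(Z w)%:E| = 0)%E by [].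
rewrite (ge0_ae_eq_integral (g := cst 0%E))//.
- by rewrite integral0.
- exact/measurable_EFinP/measurable_norm_powR.
- apply: filterS Zae => w /(_ I) /= [Zw] _.
  by rewrite Zw normr0 powR0// gt_eqF.
Qed.

Lemma class_central_moment (Y : {RV P >-> R}) p (q : \bar R) K r :
  1 <= p -> (p%:E < q)%E -> 1 < K -> 1 <= r -> (r%:E <= q)%E -> classY p q K Y ->
  exists mu, [/\ 0 <= mu, P.-integrable [set: T] (fun w => (Y w - mean Y)%:E),
    (\int[P]_w (Y w - mean Y)%:E = 0)%E, (\int[P]_w `|Y w - mean Y|%:E = mu%:E)%E &
    (\int[P]_w (`|Y w - mean Y| `^ r)%:E <=
      ((K `^ pq_exponent p q) `^ (r - 1) * mu `^ r)%:E)%E].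
Proof.
move=> p1 pq K1 r1 rq [Yq YK].
have K0 : 0 < K := lt_trans ltr01 K1.
have p0 : 0 < p := lt_le_trans ltr01 p1.
have r0 : 0 < r := lt_le_trans ltr01 r1.
have q1 : (1%:E <= q)%E by rewrite (le_trans _ (ltW pq))// lee_fin.
have PT : P [set: T] \is a fin_num by rewrite probability_setT.
have sub t : 1 <= t -> (t%:E <= q)%E -> {subset Lfun P q <= Lfun P t%:E}.
  by move=> t1 tq; apply: Lfun_subset.
have mY : measurable_fun [set: T] Y by exact: measurable_funP.
set c := mean Y in YK *; pose Z w := Y w - c.
have mZ : measurable_fun [set: T] Z by apply: measurable_funB.
have Zq : Z \in Lfun P q by exact: Lfun_centered.
have Z1 : Z \in Lfun P 1 by exact: (sub 1).
have Y1 : (Y : T -> R) \in Lfun P 1 by exact: (sub 1).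
have iZ : P.-integrable [set: T] (fun w => (Z w)%:E) by exact/Lfun1_integrable.
have [mu mu0 Zmu] := Lfun_moment (lexx 1) Z1.
have {}Zmu : (\int[P]_w `|Z w|%:E = mu%:E)%E.
  by rewrite -Zmu; apply: eq_integral => w _; rewrite powRr1.
exists mu; split => //.
  rewrite (_ : (fun w => (Y w - c)%:E) = (fun w => (Y w)%:E - c%:E)%E)//.
  rewrite integralB_EFin//; last 2 first.
  - exact/Lfun1_integrable.
  - exact: finite_measure_integrable_cst.
  rewrite integral_cst//= probability_setT mule1 /c /mean unlock fineK ?subee//.
    by have := expectation_fin_num Y1; rewrite unlock.
  by have := expectation_fin_num Y1; rewrite unlock.
move: mu0; rewrite le_eqVlt => /predU1P[mu0|mu0].
  rewrite ae_eq0_moment//; last by rewrite Zmu -mu0.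
  by rewrite lee_fin mulr_ge0 ?powR_ge0.
move: Zq q1 pq rq YK sub {Yq}; case: q => [q| |//]; last first.
  (* For q = +oo the class condition bounds |Z| almost surely by N = K mp^(1/p), so the t-th moment
     is at most N^(t-1) mu. *)
  move=> Zoo _ _ _ YK sub.
  have [mp mp0 Zmp] := Lfun_moment p1 (sub p p1 (leey _) _ Zoo).
  move: YK; rewrite /central_norm (LnormE Zmp) -EFinM.
  have P0 : (0 < P [set: T])%E by rewrite probability_setT.
  rewrite unlock; case: ifPn => [_ /ess_supP|/negP[]//].
  set N := K * mp `^ p^-1 => ZN.
  have mZ1 : measurable_fun [set: T] (fun w => `|Z w|%:E).
    by apply/measurable_EFinP; apply: measurableT_comp => //; exact: normr_measurable.
  have N0' : 0 <= N by rewrite mulr_ge0 ?powR_ge0 ?(ltW K0).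
  have N0 : 0 < N.
    apply: (lt_le_trans mu0); rewrite -lee_fin -Zmu.
    apply: (@le_trans _ _ (\int[P]_w N%:E)%E).
      apply: ae_ge0_le_integral => //.
      by apply: filterS ZN => w /= ZNw _.
    by rewrite integral_cst//= probability_setT mule1.
  have mom t : 1 <= t -> (\int[P]_w (`|Z w| `^ t)%:E <= (N `^ (t - 1) * mu)%:E)%E.
    move=> t1; rewrite EFinM -Zmu.
    rewrite -ge0_integralZl_EFin ?powR_ge0//.
    apply: ae_ge0_le_integral => //.
    - exact/measurable_EFinP/measurable_norm_powR.
    - by move=> w _; rewrite mule_ge0// lee_fin powR_ge0.
    - exact: measurable_funeM.
    - apply: filterS ZN => w /= ZNw _; rewrite -EFinM lee_fin.
      rewrite lee_fin in ZNw.
      rewrite -(mulr_powRB1 (normr_ge0 _) (lt_le_trans ltr01 t1)) mulrC ler_wpM2r//.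
      by apply: ge0_ler_powR; rewrite ?nnegrE ?subr_ge0 ?(ltW N0).
  (* At t = p the moment bound reads N^p = K^p mp <= K^p N^(p-1) mu; dividing by N^(p-1) gives kappa
     = K^p, in accordance with the convention for [pq_exponent]. *)
  have NK : N <= K `^ p * mu.
    have h : mp <= N `^ (p - 1) * mu by rewrite -lee_fin -Zmp; exact: mom.
    have NpE : N `^ p = K `^ p * mp.
      by rewrite powRM ?powR_ge0 ?(ltW K0)// -powRrM mulVf ?gt_eqF// powRr1.
    have Np0 : 0 < N `^ (p - 1) by rewrite powR_gt0.
    rewrite -(ler_pM2r Np0) (mulr_powRB1 (ltW N0) p0) NpE -mulrA ler_pM2l ?powR_gt0//.
    by rewrite mulrC.
  apply: (le_trans (mom r r1)); rewrite lee_fin /=.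
  rewrite -(mulr_powRB1 (ltW mu0) r0) [mu * _]mulrC mulrA ler_pM2r//.
  rewrite -powRM ?powR_ge0 ?(ltW mu0)//.
  have r10 : 0 <= r - 1 by rewrite subr_ge0.
  apply: (ge0_ler_powR r10) => //; rewrite nnegrE//.
  exact: le_trans NK.
move=> Zq; rewrite !lte_fin !lee_fin => q1 pq rq YK sub.
have q1' : 1 < q := le_lt_trans p1 pq.
have q10 : 0 < q - 1 by rewrite subr_gt0.
have [mp mp0 Zmp] : exists2 m, 0 <= m & (\int[P]_w (`|Z w| `^ p)%:E = m%:E)%E.
  by apply: Lfun_moment => //; apply: sub => //; rewrite lee_fin ltW.
have [mq mq0 Zmq] := Lfun_moment (ltW q1') Zq.
move: YK; rewrite /central_norm (LnormE Zmp) (LnormE Zmq) -EFinM lee_fin => YK.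
set kappa := K `^ _.
have kappa0 : 0 < kappa by rewrite powR_gt0.
have mqB : mq <= kappa `^ (q - 1) * mu `^ q.
  apply: (moment_comparison p1 pq K0 mu0 mp0 mq0 _ YK) => mq_gt0.
  rewrite -lee_fin -Zmp; apply: moment_interpolation => //; first exact: ltW.
  by rewrite Zmq.
have B0 : 0 < kappa `^ (q - 1) * mu `^ q by rewrite mulr_gt0 ?powR_gt0.
(* Interpolation between mu at exponent 1 and kappa^(q-1) mu^q at exponent q returns exactly
   kappa^(r-1) mu^r. *)
have := @moment_interpolation Z q r mu _ mZ q1' r1 rq mu0 B0 Zmu.
rewrite Zmq lee_fin => /(_ mqB).
have -> : mu `^ ((q - r) / (q - 1)) *
   (kappa `^ (q - 1) * mu `^ q) `^ ((r - 1) / (q - 1)) = kappa `^ (r - 1) * mu `^ r.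
  rewrite powRM ?powR_ge0// -!powRrM mulrCA -powRD; last by rewrite (gt_eqF mu0) implybT.
  by congr (_ `^ _ * _ `^ _); field; rewrite gt_eqF.
exact.
Qed.

End moments.

(** * Error of the two-stage algorithm *)

Section two_stage_error.
Context d (T : measurableType d) (R : realType) (P : probability T R).
Variable X : nat -> {RV P >-> R}.
Hypothesis indX : independent_sequence X.
Variables (r c mu kappa : R).
Hypotheses (r1 : 1 < r) (r2 : r <= 2).
Hypothesis iX : forall i, P.-integrable [set: T] (fun w => (X i w - c)%:E).
Hypothesis EX0 : forall i, (\int[P]_w (X i w - c)%:E = 0)%E.
Hypothesis EXr : forall i,
  (\int[P]_w (`|X i w - c| `^ r)%:E <= (kappa `^ (r - 1) * mu `^ r)%:E)%E.
Hypothesis EX1 : forall i, (\int[P]_w `|X i w - c|%:E = mu%:E)%E.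
Hypotheses (kappa0 : 0 < kappa) (mu0 : 0 <= mu).

(** A large error lies in [E1] (stage 1 underestimates by more than half) or in [E3] (the block
    length is sufficient and yet most stage 2 blocks are bad); each has probability at most delta/2.
    Placing the sufficiency of the length inside [E3] replaces conditioning on the success of stage
    1. *)
Lemma two_stage_error (eps delta s eta : R) (k k' m : nat) :
  0 < eps -> 0 < delta -> odd k -> odd k' ->
  2 * (ln delta^-1 / ln (4 / 3)) <= k%:R ->
  2 * (ln delta^-1 / ln (4 / 3)) <= k'%:R ->
  m = ceiln (3 * 48 `^ (1 / (r - 1)) * kappa) ->
  s = 1 + 1 / (r - 1) ->
  eta = 16 `^ (1 / (r - 1)) * kappa * eps `^ (- (1 + 1 / (r - 1))) ->
  (P [set w | (eps < `|stage2 k k' m 1 s eta (samples X w) - c|)%R] <= delta%:E)%E.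
Proof.
move=> e0 d0 ok ok' hk hk' mE sE etaE.
pose N : realseq R -> nat := stage2_size k m 1 s eta.
have mN : measurable_fun [set: realseq R] N by exact: measurable_stage2_size.
pose Bad1 (y : realseq R) := block_dev 1 y 0 m < mu / 2.
pose Bad2 n (y : realseq R) := eps < `|block_mean y 0 n - c|.
have mBad1 : measurable_fun [set: realseq R] Bad1.
  apply: measurable_fun_ltr; last exact: measurable_cst.
  exact: measurable_block_dev.
have mBad2 n : measurable_fun [set: realseq R] (Bad2 n).
  apply: measurable_fun_ltr; first exact: measurable_cst.
  apply: measurableT_comp; first exact: normr_measurable.
  by apply: measurable_funB; [exact: measurable_block_mean|exact: measurable_cst].
have s0 : 0 <= s by rewrite sE addr_ge0// divr_ge0// subr_ge0 ltW.
have eta0 : 0 <= eta by rewrite etaE !mulr_ge0 ?powR_ge0 ?(ltW kappa0).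
pose E1 := [set w | (k./2.+1 <= count
  (fun l => Bad1 (shifted_part (0 + l * m) (samples X w))) (iota 0 k))%N].
have PE1 : (P E1 <= (delta / 2)%:E)%E.
  apply: (@le_trans _ _ (quarter_tail R k k./2.+1)%:E); last first.
    by rewrite lee_fin; exact: quarter_tail_confidence.
  apply: majority_of_blocks => //.
    by move=> y y' yy'; rewrite /Bad1 (@block_dev_eq _ _ y y' 0 0).
  move=> l; rewrite (_ : [set w | _] =
      [set w | (block_dev 1 (samples X w) (0 + l * m) m < mu / 2)%R]).
    apply: (block_dev_confidence indX r1 r2 iX EX0 EXr EX1 kappa0 mu0) => //.
    by rewrite -ceiln_leE mE.
  apply/seteqP; split => w /=; rewrite /Bad1;
    by rewrite (@block_dev_eq _ _ _ (samples X w) 0 (0 + l * m)%N).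
(* For mu = 0 the second clause would admit n = 0; positivity comes from the maximum with 1 in the
   block length. *)
pose C n := (0 < n)%N /\ eta * (mu / 2) `^ s <= n%:R.
pose F n : set (realseq R) := [set y | (k'./2.+1 <= count
  (fun l => Bad2 n (shifted_part (0 + l * n) y)) (iota 0 k'))%N].
pose E3 := [set w | C (N (samples X w)) /\
  F (N (samples X w)) (shifted_part (k * m) (samples X w))].
have mF n : measurable (F n).
  rewrite -[X in measurable X]setTI.
  apply: (@measurable_count _ (realseq R) (fun l (y : realseq R) =>
    Bad2 n (shifted_part (0 + l * n) y)) k' _ _ [set j | (k'./2.+1 <= j)%N]) => //.
  by move=> l; exact: (measurableT_comp (mBad2 n) (measurable_shifted_part _)).
have PE3 : (P E3 <= (delta / 2)%:E)%E.
  apply: (@random_index_le _ _ _ P X indX (k * m) N C F (delta / 2) mN).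
  - by move=> y; apply: stage2_size_eq => j jkm; rewrite /initial_part jkm.
  - exact: mF.
  - move=> n [n0 hn].
    apply: (@le_trans _ _ (quarter_tail R k' k'./2.+1)%:E); last first.
      by rewrite lee_fin; exact: quarter_tail_confidence.
    have := @majority_of_blocks _ _ _ P X indX (Bad2 n) (k * m) n k' k'./2.+1 (mBad2 n).
    rewrite (_ : [set w | _] = (shifted_part (k * m) \o samples X) @^-1` F n); last first.
      apply/seteqP; split => w /=; rewrite /F/=; congr (_ < _)%N;
        apply: eq_count => l; rewrite add0n; congr Bad2; apply/funext => j;
        by rewrite /shifted_part addnA.
    apply.
      by move=> y y' yy'; rewrite /Bad2 (@block_mean_eq _ y y' 0 0).
    move=> l; rewrite (_ : [set w | _] =
        [set w | (eps < `|block_mean (samples X w) (k * m + l * n) n - c|)%R]).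
      apply: (block_mean_confidence indX r1 r2 iX EX0 EXr kappa0 mu0) => //.
      by rewrite -etaE -sE.
    apply/seteqP; split => w /=; rewrite /Bad2;
      by rewrite (@block_mean_eq _ _ (samples X w) 0 (k * m + l * n)%N).
  - by rewrite divr_ge0 ?ltW.
have mE1 : measurable E1.
  rewrite -[X in measurable X]setTI.
  apply: (@measurable_count _ T (fun l w =>
    Bad1 (shifted_part (0 + l * m) (samples X w))) k _ _ [set j | (k./2.+1 <= j)%N]) => //.
  move=> l; apply: (measurableT_comp mBad1).
  exact: (measurableT_comp (measurable_shifted_part _) (measurable_samples X)).
have mE3 : measurable E3.
  rewrite (_ : E3 = \bigcup_n ((N \o samples X) @^-1` [set n] `&`
      (if `[< C n >] then (shifted_part (k * m) \o samples X) @^-1` F n else set0))).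
    apply: bigcupT_measurable => n; apply: measurableI.
      rewrite -[X in measurable X]setTI.
      exact: (measurableT_comp mN (measurable_samples X)).
    case: ifP => // _; rewrite -[X in measurable X]setTI.
    by apply: (measurableT_comp (measurable_shifted_part (k * m)) (measurable_samples X)).
  apply/seteqP; split => w /=.
    by move=> [Cw Fw]; exists (N (samples X w)) => //; rewrite asboolT.
  by move=> [n _ [/= <-]]; case: ifPn => // /asboolP Cn Fn; split.
apply: (@le_trans _ _ (P E1 + P E3)%E); last first.
  by rewrite [delta]splitr EFinD leeD.
apply: (le_trans _ (measureU2 _ mE1 mE3)).
apply: le_measure; rewrite ?inE.
- apply: measurable_gt_set; apply: measurableT_comp; first exact: normr_measurable.
  apply: measurable_funB; last exact: measurable_cst.
  exact: (measurableT_comp (measurable_stage2 m 1 s eta ok ok') (measurable_samples X)).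
- exact: measurableU.
move=> w /= herr.
have [h1|h1] := boolP (k./2.+1 <= count
  (fun l => Bad1 (shifted_part (0 + l * m) (samples X w))) (iota 0 k))%N; first by left.
right; split.
  split; first by rewrite /N/stage2_size leq_max orbT.
  (* Outside [E1] the stage 1 median is at least mu/2, and monotonicity of t^s carries this to the
     block length. *)
  have hs1 : mu / 2 <= stage1 k m 1 (samples X w).
    rewrite leNgt; apply: contra h1 => h.
    move: h; rewrite /stage1 median_ltE size_mkseq// /mkseq count_map => h.
    apply: (leq_trans h); apply: sub_count => l /=; rewrite /Bad1.
    by rewrite (@block_dev_eq _ _ _ (samples X w) 0 (l * m)%N)// => j _;
      rewrite /shifted_part add0n.
  apply: (@le_trans _ _ (eta * stage1 k m 1 (samples X w) `^ s)).
    apply: ler_wpM2l => //; apply: ge0_ler_powR => //; rewrite nnegrE.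
      by rewrite divr_ge0.
    by apply: le_trans hs1; rewrite divr_ge0.
  by rewrite -ceiln_leE /N /stage2_size leq_maxl.
have := median_err_count (s := mkseq (fun l => block_mean (samples X w)
  (k * m + l * N (samples X w)) (N (samples X w))) k') (c := c) (e := eps).
rewrite size_mkseq => /(_ ok' herr); rewrite /mkseq count_map => h.
apply: (leq_trans h); apply: sub_count => l /=; rewrite /Bad2.
rewrite (@block_mean_eq _ _ (samples X w) 0 (k * m + l * N (samples X w))%N)// => j _.
by rewrite /shifted_part !add0n addnA.
Qed.

End two_stage_error.

(** * Transfer of integrals between variables with the same law *)

Section identically_distributed.
Context (R : realType) d (T : measurableType d) (P : probability T R)
  d' (T' : measurableType d') (P' : probability T' R)
  (Y : {RV P >-> R}) (Z : {RV P' >-> R}).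
Hypothesis lawZ : forall B, measurable B -> distribution P' Z B = distribution P Y B.

Lemma ge0_integral_law (g : R -> \bar R) : measurable_fun [set: R] g ->
  (forall x, 0 <= g x)%E -> (\int[P']_w g (Z w) = \int[P]_w g (Y w))%E.
Proof.
move=> mg g0.
have := @ge0_integral_distribution _ _ _ _ _ P' Z g mg g0.
have := @ge0_integral_distribution _ _ _ _ _ P Y g mg g0.
move=> /= <- <-; apply: eq_measure_integral => /= A mA _; exact: lawZ.
Qed.

Lemma integrable_law (g : R -> R) : measurable_fun [set: R] g ->
  P.-integrable [set: T] (fun w => (g (Y w))%:E) ->
  P'.-integrable [set: T'] (fun w => (g (Z w))%:E).
Proof.
move=> mg /integrableP[_ Yoo]; apply/integrableP; split.
  by apply/measurable_EFinP; apply: measurableT_comp.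
rewrite (ge0_integral_law (g := fun x => `|(g x)%:E|%E))//.
by apply: measurableT_comp => //; exact/measurable_EFinP.
Qed.

Lemma integral_law (g : R -> R) : measurable_fun [set: R] g ->
  P.-integrable [set: T] (fun w => (g (Y w))%:E) ->
  (\int[P']_w (g (Z w))%:E = \int[P]_w (g (Y w))%:E)%E.
Proof.
move=> mg iY; have iZ := integrable_law mg iY.
have mEg : measurable_fun [set: R] (EFin \o g) by exact/measurable_EFinP.
have := integral_distribution mEg iZ; have := integral_distribution mEg iY.
move=> /= <- <-; apply: eq_measure_integral => /= A mA _; exact: lawZ.
Qed.

End identically_distributed.

(** The free exponent r covers both parameter regimes: r = q when q <= 2, and r = 2 otherwise, where
    3 * 48 = 144 and 1 + 1/(r-1) = 2. *)
Lemma two_stage_approximating (R : realType) (p : R) (q : \bar R) (K r : R)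
    (eps delta s eta : R) (k k' m : nat) :
  1 <= p -> (p%:E < q)%E -> 1 < K -> 1 < r -> r <= 2 -> (r%:E <= q)%E ->
  0 < eps -> 0 < delta -> odd k -> odd k' ->
  2 * (ln delta^-1 / ln (4 / 3)) <= k%:R ->
  2 * (ln delta^-1 / ln (4 / 3)) <= k'%:R ->
  m = ceiln (3 * 48 `^ (1 / (r - 1)) * K `^ pq_exponent p q) ->
  s = 1 + 1 / (r - 1) ->
  eta = 16 `^ (1 / (r - 1)) * K `^ pq_exponent p q * eps `^ (- (1 + 1 / (r - 1))) ->
  approximating (two_stage k k' m 1 s eta) eps delta (classY p q K).
Proof.
move=> p1 pq K1 r1 r2 rq e0 d0 ok ok' hk hk' mE sE etaE d T P Y YK d' T' P' U X.
move=> [_ lawX indUX].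
have [mu [mu0 iY EY0 EY1 EYr]] := class_central_moment p1 pq K1 (ltW r1) rq YK.
have indX : independent_sequence X.
  move=> J C uJ mC; have := indUX J setT C uJ measurableT mC.
  by rewrite preimage_setT setTI probability_setT mul1e.
set c := mean Y in iY EY0 EY1 EYr *.
have mc : measurable_fun [set: R] (fun x : R => x - c).
  by apply: measurable_funB => //; exact: measurable_cst.
have kappa0 : 0 < K `^ pq_exponent p q by rewrite powR_gt0// (lt_trans ltr01).
have herr : (P' [set w | (eps < `|stage2 k k' m 1 s eta (samples X w) - c|)%R] <= delta%:E)%E.
  apply: (@two_stage_error _ _ _ P' X indX r c mu (K `^ pq_exponent p q)) => // i.
  - exact: (integrable_law (lawX i) mc).
  - by rewrite (integral_law (lawX i) mc).
  - rewrite (ge0_integral_law (lawX i) (g := fun x => (`|x - c| `^ r)%:E))//.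
    by apply/measurable_EFinP/measurable_norm_powR.
  - rewrite (ge0_integral_law (lawX i) (g := fun x => `|x - c|%:E))//.
    by apply/measurable_EFinP; apply: measurableT_comp => //; exact: normr_measurable.
pose Good := [set w | (`|stage2 k k' m 1 s eta (samples X w) - c| <= eps)%R].
rewrite (_ : [set w | _] = Good); last first.
  have runE w := run_two_stage (U w) (samples X w).
  apply/funext => w; rewrite /Good /mkset.
  exact: (congr1 (fun z => is_true (`|z - c| <= eps)) (runE w)).
have mGood : measurable Good.
  apply: measurable_le_set; apply: measurableT_comp; first exact: normr_measurable.
  apply: measurable_funB; last exact: measurable_cst.
  exact: (measurableT_comp (measurable_stage2 m 1 s eta ok ok') (measurable_samples X)).
have GoodC : ~` Good = [set w | (eps < `|stage2 k k' m 1 s eta (samples X w) - c|)%R].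
  by apply/seteqP; split => w /=; rewrite ltNge => /negP.
rewrite -[Good]setCK probability_setC; last exact: measurableC.
by rewrite EFinB leeB// GoodC.
Qed.

Lemma odd_above (R : realType) (x : R) : exists2 k, odd k & x <= k%:R.
Proof.
exists (ceiln x).*2.+1; first by rewrite /= odd_double.
by rewrite -ceiln_leE -addnn -addnS leq_addr.
Qed.


Theorem theorem2p15 (R : realType) (p : R) (q : \bar R) (K : R)
    (p_ge1 : 1 <= p) (pq : (p%:E < q)%E) (K_gt1 : 1 < K) :
  solvable (classY p q K) /\
  forall (eps delta : R) (k k' : nat),
    0 < eps -> 0 < delta ->
    odd k -> odd k' ->
    2 * (ln delta^-1 / ln (4 / 3)) <= k%:R ->
    2 * (ln delta^-1 / ln (4 / 3)) <= k'%:R ->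
    ((q <= 2%:E)%E ->
       let r := fine q in
       let m := ceiln (3 * 48 `^ (1 / (r - 1)) * K `^ pq_exponent p q) in
       let s := 1 + 1 / (r - 1) in
       let eta := 16 `^ (1 / (r - 1)) * K `^ pq_exponent p q
                  * eps `^ (- (1 + 1 / (r - 1))) in
       iid_based (two_stage k k' m 1 s eta) (classY p q K) /\
       approximating (two_stage k k' m 1 s eta) eps delta (classY p q K)) /\
    ((2%:E <= q)%E ->
       let m := ceiln (144 * K `^ pq_exponent p q) in
       let s := 2 in
       let eta := 16 * K `^ pq_exponent p q * eps `^ (- 2) in
       iid_based (two_stage k k' m 1 s eta) (classY p q K) /\
       approximating (two_stage k k' m 1 s eta) eps delta (classY p q K)).
Proof.
(* The explicit parameters also witness solvability, so the quantitative conjunct is established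
   first. *)
have main : forall (eps delta : R) (k k' : nat),
    0 < eps -> 0 < delta -> odd k -> odd k' ->
    2 * (ln delta^-1 / ln (4 / 3)) <= k%:R ->
    2 * (ln delta^-1 / ln (4 / 3)) <= k'%:R ->
    ((q <= 2%:E)%E ->
       let r := fine q in
       let m := ceiln (3 * 48 `^ (1 / (r - 1)) * K `^ pq_exponent p q) in
       let s := 1 + 1 / (r - 1) in
       let eta := 16 `^ (1 / (r - 1)) * K `^ pq_exponent p q
                  * eps `^ (- (1 + 1 / (r - 1))) in
       iid_based (two_stage k k' m 1 s eta) (classY p q K) /\
       approximating (two_stage k k' m 1 s eta) eps delta (classY p q K)) /\
    ((2%:E <= q)%E ->
       let m := ceiln (144 * K `^ pq_exponent p q) in
       let s := 2 in
       let eta := 16 * K `^ pq_exponent p q * eps `^ (- 2) in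
       iid_based (two_stage k k' m 1 s eta) (classY p q K) /\
       approximating (two_stage k k' m 1 s eta) eps delta (classY p q K)).
  move=> eps delta k k' e0 d0 ok ok' hk hk'; split => hq.
    split; first exact: iid_based_two_stage.
    (* Here 1 <= p < q <= 2 makes q finite, so [fine q] is its real value rather than the default
       0. *)
    have qE : q = (fine q)%:E.
      by case: q pq hq => // qq _; rewrite leye_eq.
    apply: (@two_stage_approximating R p q K (fine q)) => //.
    - by rewrite -lte_fin -qE (le_lt_trans _ pq)// lee_fin.
    - by rewrite -lee_fin -qE.
    - by rewrite -qE.
  split; first exact: iid_based_two_stage.
  have e1 : 1 / (2 - 1) = 1 :> R by field.
  apply: (@two_stage_approximating R p q K 2) => //.
  - by rewrite ltr1n.
  - by rewrite e1 powRr1// -natrM.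
  - by rewrite e1.
  - by rewrite e1 powRr1.
split; last exact: main.
move=> eps delta e0 d0 _.
have [k ok hk] := odd_above (2 * (ln delta^-1 / ln (4 / 3))).
have [h1 h2] := main eps delta k k e0 d0 ok ok hk hk.
have [hq|/ltW hq] := leP q 2%:E; first by eexists; exact: h1.
by eexists; exact: h2.
Qed.
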